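(* Let $A, X \in 2^\omega$ be reals with $X \geq_{tt} A'$. Then there is a real $Y \geq_{tt} A$ such that $X \equiv_{tt} Y' \equiv_{tt} Y \oplus A'$.
   Context: Reals are elements of $2^\omega$. A Turing functional $\Phi$ is a truth-table reduction if there is a computable $f:\omega\to\omega$ such that for every $n$ and every binary string $\sigma$ of length $f(n)$, $\Phi^\sigma(n)$ converges; $A\leq_{tt}B$ means $\Phi(B)=A$ for some truth-table reduction $\Phi$, and $A\equiv_{tt}B$ means reducibility in both directions. $Z'$ denotes the Turing jump of $Z$, and $A\oplus B=\{2n:n\in A\}\cup\{2n+1:n\in B\}$. *)

(* Defs.v *)
From Stdlib Require Import Arith List Cantor ClassicalDescription.
Import ListNotations.

Definition real := nat -> bool.

Inductive prog : Type :=
| Zero : prog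
| Succ : prog
| Proj : nat -> prog
| Orc  : prog
| Comp : prog -> list prog -> prog
| Prec : prog -> prog -> prog
| Mu   : prog -> prog.

(* An oracle is a partial map: a real gives a total oracle, a finite binary
   string sigma gives the oracle defined exactly below |sigma|.  Queries
   where the oracle is undefined make the computation diverge. *)
Definition oracle := nat -> option bool.

Inductive eval (O : oracle) : prog -> list nat -> nat -> Prop :=
| e_zero args : eval O Zero args 0
| e_succ args : eval O Succ args (S (hd 0 args))
| e_proj i args : eval O (Proj i) args (nth i args 0)
| e_orc args b : O (hd 0 args) = Some b -> eval O Orc args (if b then 1 else 0)
| e_comp f gs args ys v :
    evals O gs args ys -> eval O f ys v -> eval O (Comp f gs) args v
| e_prec0 g h rest v : eval O g rest v -> eval O (Prec g h) (0 :: rest) v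
| e_precS g h y rest w v :
    eval O (Prec g h) (y :: rest) w -> eval O h (y :: w :: rest) v ->
    eval O (Prec g h) (S y :: rest) v
| e_mu f args v :
    eval O f (v :: args) 0 ->
    (forall y, y < v -> exists w, w <> 0 /\ eval O f (y :: args) w) ->
    eval O (Mu f) args v
with evals (O : oracle) : list prog -> list nat -> list nat -> Prop :=
| es_nil args : evals O [] args []
| es_cons g gs args y ys :
    eval O g args y -> evals O gs args ys -> evals O (g :: gs) args (y :: ys).

(* Goedel numbering (Cantor pairing; fuel n suffices since subcodes are < n). *)
Fixpoint dec (fuel n : nat) {struct fuel} : prog :=
  match fuel with
  | 0 => Zero
  | S k =>
    let '(tag, r) := Cantor.of_nat n in
    match tag with
    | 0 => Zero
    | 1 => Succ
    | 2 => Proj r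
    | 3 => Orc
    | 4 => let '(a, b) := Cantor.of_nat r in Comp (dec k a) (decl k b)
    | 5 => let '(a, b) := Cantor.of_nat r in Prec (dec k a) (dec k b)
    | _ => Mu (dec k r)
    end
  end
with decl (fuel n : nat) {struct fuel} : list prog :=
  match fuel with
  | 0 => []
  | S k =>
    match n with
    | 0 => []
    | S m => let '(a, b) := Cantor.of_nat m in dec k a :: decl k b
    end
  end.

Definition decode (e : nat) : prog := dec e e.

Definition real_oracle (B : real) : oracle := fun i => Some (B i).
Definition string_oracle (s : list bool) : oracle := fun i => nth_error s i.

Definition converges (p : prog) (O : oracle) (n : nat) : Prop :=
  exists v, eval O p [n] v.

Definition computable (f : nat -> nat) : Prop :=
  exists p, forall n, eval (fun _ => None) p [n] (f n).

Definition tt_functional (p : prog) : Prop :=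
  exists f : nat -> nat, computable f /\
    forall n (s : list bool), length s = f n -> converges p (string_oracle s) n.

Definition computes (p : prog) (B A : real) : Prop :=
  forall n, eval (real_oracle B) p [n] (if A n then 1 else 0).

Definition tt_le (A B : real) : Prop :=
  exists p, tt_functional p /\ computes p B A.

Definition tt_equiv (A B : real) : Prop := tt_le A B /\ tt_le B A.

Definition jump (Z : real) : real :=
  fun e => if excluded_middle_informative (converges (decode e) (real_oracle Z) e)
           then true else false.

Definition join (A B : real) : real :=
  fun n => if Nat.even n then A (Nat.div2 n) else B (Nat.div2 n).

(* Main.v *)
(** [Y] is [join A Z] with [Z] in the Pi^0_1(A) class of functions into [{0,1}] that are
    diagonally non-computable relative to [A]. A number [h], the history, indexes the
    subclass [P_h] obtained from the decisions made so far. Stage [n] first codes [X n]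
    as the bit [Z (pair e h)], where [e] is the index of a program that on input
    [pair e h] searches for a bit forced at this position by [P_h] and outputs it: if
    [P_h] forced a bit, diagonal non-computability would make [P_h] empty, so both bits
    are possible. It then adds the requirement that the [n]-th program diverges at [n]
    with oracle [Y], if this leaves a nonempty class; otherwise the program converges on
    the whole class. By compactness emptiness is Sigma^0_1(A), hence one query to
    [jump A] at a position computed from the history. Since coding positions also depend
    on the history alone, with no search, histories are computed by primitive recursion
    from [X] or [Y] for the bits and [jump A] or [jump Y] for the decisions, and a
    primitive recursive functional has a computable bound on its use. *)
Require Import Defs.
From Stdlib Require Import Arith List Lia Cantor Bool Classical ClassicalDescription.
Import ListNotations.

(** * Evaluation *)

(* The generated scheme gives no induction hypothesis under the existential in [e_mu]. *)
Lemma eval_induction (O : oracle) (P : prog -> list nat -> nat -> Prop)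
    (Q : list prog -> list nat -> list nat -> Prop) :
  (forall a, P Zero a 0) ->
  (forall a, P Succ a (S (hd 0 a))) ->
  (forall i a, P (Proj i) a (nth i a 0)) ->
  (forall a b, O (hd 0 a) = Some b -> P Orc a (if b then 1 else 0)) ->
  (forall f gs a ys v, Q gs a ys -> P f ys v -> P (Comp f gs) a v) ->
  (forall g h r v, P g r v -> P (Prec g h) (0 :: r) v) ->
  (forall g h y r w v,
     P (Prec g h) (y :: r) w -> P h (y :: w :: r) v -> P (Prec g h) (S y :: r) v) ->
  (forall f a v, P f (v :: a) 0 ->
     (forall y, y < v -> exists w, w <> 0 /\ P f (y :: a) w) -> P (Mu f) a v) ->
  (forall a, Q [] a []) ->
  (forall g gs a y ys, P g a y -> Q gs a ys -> Q (g :: gs) a (y :: ys)) ->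
  forall p a v, eval O p a v -> P p a v.
Proof.
  intros H0 H1 H2 H3 H4 H5 H6 H7 H8 H9.
  fix F 4 with (G gs a ys (H : evals O gs a ys) {struct H} : Q gs a ys).
  - intros p a v H. destruct H as [| | | | | | |f a v E N].
    + apply H0.
    + apply H1.
    + apply H2.
    + now apply H3.
    + eapply H4; [eapply G | eapply F]; eassumption.
    + apply H5, F; assumption.
    + eapply H6; eapply F; eassumption.
    + apply H7; [now apply F|].
      intros y Hy. destruct (N y Hy) as [w [Hw Ew]].
      exists w. split; [exact Hw | exact (F _ _ _ Ew)].
  - intros gs a ys H. destruct H.
    + apply H8.
    + apply H9; [apply F | apply G]; assumption.
Qed.

Lemma eval_functional O p a v : eval O p a v -> forall v', eval O p a v' -> v = v'.
Proof.
  revert p a v.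
  apply (eval_induction O (fun p a v => forall v', eval O p a v' -> v = v')
           (fun gs a ys => forall ys', evals O gs a ys' -> ys = ys')).
  - intros a v' E. now inversion E.
  - intros a v' E. now inversion E.
  - intros i a v' E. now inversion E.
  - intros a b H v' E. inversion E as [| | |? b' H'| | | |]; subst. rewrite H in H'. now injection H' as ->.
  - intros f gs a ys v IHs IH v' E. inversion E; subst.
    apply IH. erewrite IHs; eassumption.
  - intros g h r v IH v' E. inversion E; subst. now apply IH.
  - intros g h y r w v IHw IH v' E. inversion E; subst.
    apply IH. erewrite IHw; eassumption.
  - intros f a v IH N v' E. inversion E as [| | | | | | |f' a' u E0 N']; subst.
    destruct (lt_eq_lt_dec v v') as [[L | ->] | L]; [| reflexivity |].
    + destruct (N' v L) as [w [Hw Ew]]. apply IH in Ew. congruence.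
    + destruct (N v' L) as [w [Hw IHw]]. apply IHw in E0. congruence.
  - intros a ys' E. now inversion E.
  - intros g gs a y ys IH IHs ys' E. inversion E; subst. f_equal; auto.
Qed.

(** [Orc] looks only at the head of its argument list, so [r] is applied to that head alone,
    extracted by [Proj 0]. *)
Fixpoint subst_orc (r p : prog) : prog :=
  match p with
  | Orc => Comp r [Proj 0]
  | Comp f gs => Comp (subst_orc r f) (map (subst_orc r) gs)
  | Prec g h => Prec (subst_orc r g) (subst_orc r h)
  | Mu f => Mu (subst_orc r f)
  | p => p
  end.

Lemma nth_0_hd (a : list nat) : nth 0 a 0 = hd 0 a.
Proof. now destruct a. Qed.

Lemma eval_subst_orc (O O' : oracle) (r : prog) :
  (forall i b, O i = Some b -> eval O' r [i] (if b then 1 else 0)) ->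
  forall p a v, eval O p a v -> eval O' (subst_orc r p) a v.
Proof.
  intros Hr.
  apply (eval_induction O (fun p a v => eval O' (subst_orc r p) a v)
           (fun gs a ys => evals O' (map (subst_orc r) gs) a ys));
    cbn; intros; try (econstructor; eassumption).
  - econstructor.
    + repeat constructor.
    + rewrite nth_0_hd. now apply Hr.
Qed.

Lemma eval_mono (O O' : oracle) :
  (forall i b, O i = Some b -> O' i = Some b) ->
  forall p a v, eval O p a v -> eval O' p a v.
Proof.
  intros HO.
  apply (eval_induction O (eval O') (evals O')); intros;
    econstructor; eauto.
Qed.

(** * Codes of programs and lists *)

Definition pair (x y : nat) : nat := Cantor.to_nat (x, y).
Definition p1 (n : nat) : nat := fst (Cantor.of_nat n).
Definition p2 (n : nat) : nat := snd (Cantor.of_nat n).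

Lemma p1_pair x y : p1 (pair x y) = x.
Proof. unfold p1, pair. now rewrite Cantor.cancel_of_to. Qed.

Lemma p2_pair x y : p2 (pair x y) = y.
Proof. unfold p2, pair. now rewrite Cantor.cancel_of_to. Qed.

Lemma pair_p n : pair (p1 n) (p2 n) = n.
Proof.
  unfold pair, p1, p2. rewrite <- surjective_pairing. apply Cantor.cancel_to_of.
Qed.

Lemma of_nat_p n : Cantor.of_nat n = (p1 n, p2 n).
Proof. apply surjective_pairing. Qed.

Lemma pair_le x y : x <= pair x y /\ y <= pair x y.
Proof. unfold pair. pose proof (Cantor.to_nat_non_decreasing x y). lia. Qed.

Lemma p_le n : p1 n <= n /\ p2 n <= n.
Proof. pose proof (pair_le (p1 n) (p2 n)). now rewrite pair_p in H. Qed.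

Lemma p2_lt n : p1 n <> 0 -> p2 n < n.
Proof.
  intros H. pose proof (pair_p n) as E. unfold pair in E.
  pose proof (Cantor.to_nat_non_decreasing (p1 n) (p2 n)). lia.
Qed.

Global Opaque pair p1 p2.

(** This is the list coding of [decl]: 0 codes the empty list, hence the successor. Since
    [p1 0 = 0], [hdn 0] matches the default value of [hd 0]. *)
Definition consn (x l : nat) : nat := S (pair x l).
Definition hdn (l : nat) : nat := p1 (pred l).
Definition tln (l : nat) : nat := p2 (pred l).

Lemma hdn_cons x l : hdn (consn x l) = x.
Proof. apply p1_pair. Qed.

Lemma tln_cons x l : tln (consn x l) = l.
Proof. apply p2_pair. Qed.

Fixpoint enc (l : list nat) : nat :=
  match l with [] => 0 | x :: l => consn x (enc l) end.

Lemma p1_0 : p1 0 = 0.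
Proof. pose proof (p_le 0). lia. Qed.

Lemma p2_0 : p2 0 = 0.
Proof. pose proof (p_le 0). lia. Qed.

Lemma hdn_enc l : hdn (enc l) = hd 0 l.
Proof. destruct l; cbn [enc]; [apply p1_0 | apply hdn_cons]. Qed.

Lemma tln_enc l : tln (enc l) = enc (tl l).
Proof. destruct l; cbn [enc]; [apply p2_0 | apply tln_cons]. Qed.

Definition decodel (n : nat) : list prog := decl n n.

Lemma dec_S k n :
  dec (S k) n =
    match p1 n with
    | 0 => Zero
    | 1 => Succ
    | 2 => Proj (p2 n)
    | 3 => Orc
    | 4 => Comp (dec k (p1 (p2 n))) (decl k (p2 (p2 n)))
    | 5 => Prec (dec k (p1 (p2 n))) (dec k (p2 (p2 n)))
    | _ => Mu (dec k (p2 n))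
    end.
Proof. cbn [dec]. now rewrite of_nat_p, (of_nat_p (p2 n)). Qed.

Lemma decl_S k n :
  decl (S k) n =
    match n with 0 => [] | S _ => dec k (hdn n) :: decl k (tln n) end.
Proof. destruct n; cbn [decl]; [reflexivity|]. now rewrite of_nat_p. Qed.

Lemma dec_fuel k : forall k' n, n <= k -> n <= k' ->
  dec k n = dec k' n /\ decl k n = decl k' n.
Proof.
  induction k as [|k IH]; intros k' n L L'.
  - assert (n = 0) as -> by lia. destruct k'; [easy|].
    rewrite dec_S, decl_S, p1_0. easy.
  - destruct k' as [|k'].
    + assert (n = 0) as -> by lia. rewrite dec_S, decl_S, p1_0. easy.
    + assert (B : forall x, x < n -> dec k x = dec k' x /\ decl k x = decl k' x)
        by (intros; apply IH; lia).
      rewrite !dec_S, !decl_S. split.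
      (* The payload is smaller than the code only for a nonzero tag; for tag 0 it is not
         decoded. *)
      * pose proof (p2_lt n) as Lt. pose proof (p_le (p2 n)).
        destruct (p1 n) as [|t]; [reflexivity|].
        specialize (Lt ltac:(lia)).
        destruct (B (p1 (p2 n))) as [-> _]; [lia|].
        destruct (B (p2 (p2 n))) as [-> ->]; [lia|].
        destruct (B (p2 n)) as [-> _]; [lia|]. reflexivity.
      * destruct n as [|n]; [reflexivity|].
        pose proof (p_le n). unfold hdn, tln. cbn [pred].
        destruct (B (p1 n)) as [-> _]; [lia|].
        destruct (B (p2 n)) as [_ ->]; [lia|]. reflexivity.
Qed.

Lemma decode_eq n :
  decode n =
    match p1 n with
    | 0 => Zero
    | 1 => Succ
    | 2 => Proj (p2 n)
    | 3 => Orc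
    | 4 => Comp (decode (p1 (p2 n))) (decodel (p2 (p2 n)))
    | 5 => Prec (decode (p1 (p2 n))) (decode (p2 (p2 n)))
    | _ => Mu (decode (p2 n))
    end.
Proof.
  unfold decode, decodel.
  rewrite (proj1 (dec_fuel n (S n) n ltac:(lia) ltac:(lia))), dec_S.
  pose proof (p_le n). pose proof (p_le (p2 n)).
  rewrite (proj1 (dec_fuel n (p2 n) (p2 n) ltac:(lia) ltac:(lia))).
  rewrite (proj1 (dec_fuel n (p1 (p2 n)) (p1 (p2 n)) ltac:(lia) ltac:(lia))).
  destruct (dec_fuel n (p2 (p2 n)) (p2 (p2 n)) ltac:(lia) ltac:(lia)) as [-> ->].
  reflexivity.
Qed.

Lemma decodel_eq n :
  decodel n = match n with 0 => [] | S _ => decode (hdn n) :: decodel (tln n) end.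
Proof.
  unfold decode, decodel.
  rewrite (proj2 (dec_fuel n (S n) n ltac:(lia) ltac:(lia))), decl_S.
  destruct n as [|n]; [reflexivity|].
  pose proof (p_le n). unfold hdn, tln. cbn [pred].
  rewrite (proj1 (dec_fuel (S n) (p1 n) (p1 n) ltac:(lia) ltac:(lia))).
  now rewrite (proj2 (dec_fuel (S n) (p2 n) (p2 n) ltac:(lia) ltac:(lia))).
Qed.

Lemma decodel_cons x l : decodel (consn x l) = decode x :: decodel l.
Proof. rewrite decodel_eq. unfold consn at 1. now rewrite hdn_cons, tln_cons. Qed.

Ltac decode_pair := rewrite decode_eq, ?p1_pair, ?p2_pair, ?p1_pair, ?p2_pair.

Lemma decode_comp f gs :
  decode (pair 4 (pair f gs)) = Comp (decode f) (decodel gs).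
Proof. now decode_pair. Qed.

Lemma decode_surj : forall p, exists c, decode c = p.
Proof.
  fix F 1. intros [| |i| |f gs|g h|f].
  - exists (pair 0 0). now decode_pair.
  - exists (pair 1 0). now decode_pair.
  - exists (pair 2 i). now decode_pair.
  - exists (pair 3 0). now decode_pair.
  - destruct (F f) as [cf <-].
    assert (exists cs, decodel cs = gs) as [cs <-].
    { revert gs. fix G 1. intros [|g gs].
      - now exists 0.
      - destruct (F g) as [c <-], (G gs) as [cs <-].
        exists (consn c cs). apply decodel_cons. }
    exists (pair 4 (pair cf cs)). now decode_pair.
  - destruct (F g) as [cg <-], (F h) as [ch <-].
    exists (pair 5 (pair cg ch)). now decode_pair.
  - destruct (F f) as [cf <-]. exists (pair 6 cf). now decode_pair.
Qed.

Definition const_prog (n : nat) : prog :=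
  nat_rect (fun _ => prog) Zero (fun _ p => Comp Succ [p]) n.

Lemma eval_const_prog O n a : eval O (const_prog n) a n.
Proof.
  induction n as [|n IH]; cbn; [constructor|].
  econstructor; [econstructor; [exact IH | constructor]|].
  apply (e_succ O [n]).
Qed.

Definition const_code (n : nat) : nat :=
  nat_rect (fun _ => nat) 0 (fun _ c => pair 4 (pair (pair 1 0) (consn c 0))) n.

Lemma decode_const_code n : decode (const_code n) = const_prog n.
Proof.
  induction n as [|n IH]; cbn [const_code const_prog nat_rect]; [reflexivity|].
  fold (const_code n). fold (const_prog n).
  rewrite decode_comp, decodel_cons, IH. now rewrite (decode_eq (pair 1 0)), p1_pair.
Qed.

(** Composition with a constant program discards the input. Hence the jump at [smn c n] decides
    whether program [c] converges on [n], although the jump feeds each program its own index. *)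
Definition smn (c n : nat) : nat := pair 4 (pair c (consn (const_code n) 0)).

Lemma converges_smn c n O x :
  converges (decode (smn c n)) O x <-> exists v, eval O (decode c) [n] v.
Proof.
  unfold smn, converges.
  rewrite decode_comp, decodel_cons, decode_const_code.
  split; intros [v E]; exists v.
  - inversion E as [| | | |? ? ? ys ? Es Ef| | |]; subst.
    inversion Es as [|? ? ? y ys' Ey En]; subst. inversion En; subst.
    now rewrite (eval_functional _ _ _ _ (eval_const_prog O n [x]) _ Ey).
  - econstructor; [|exact E]. repeat constructor. apply eval_const_prog.
Qed.

(** * Primitive recursive functionals *)

(* [F D a] is computed from the oracle [D] with value and use below [b a], where
   [b] is monotone and computed without the oracle; the arity [k] is the length of [a]. *)
Definition rex (k : nat) (F : real -> list nat -> nat) : Prop :=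
  exists (p q : prog) (b : list nat -> nat),
    (forall O a, length a = k -> eval O q a (b a)) /\
    (forall a a', Forall2 le a a' -> b a <= b a') /\
    (forall D a, length a = k -> F D a <= b a /\
       forall O : oracle, (forall i, i < b a -> O i = Some (D i)) -> eval O p a (F D a)).

Lemma rex_ext k F G :
  (forall D a, length a = k -> F D a = G D a) -> rex k F -> rex k G.
Proof.
  intros E (p & q & b & Hq & Hm & Hp). exists p, q, b. repeat split; auto.
  - rewrite <- E by assumption. now apply Hp.
  - intros O HO. rewrite <- E by assumption. now apply Hp.
Qed.

Lemma eval_comp1 O f g a x v :
  eval O g a x -> eval O f [x] v -> eval O (Comp f [g]) a v.
Proof. intros. econstructor; [|eassumption]. repeat constructor; assumption. Qed.

Lemma eval_comp2 O f g h a x y v :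
  eval O g a x -> eval O h a y -> eval O f [x; y] v -> eval O (Comp f [g; h]) a v.
Proof. intros. econstructor; [|eassumption]. repeat constructor; assumption. Qed.

Definition add_prog : prog := Prec (Proj 0) (Comp Succ [Proj 1]).

Lemma eval_add_prog O x y : eval O add_prog [x; y] (x + y).
Proof.
  induction x as [|x IH]; cbn.
  - constructor. apply (e_proj O 0 [y]).
  - econstructor; [exact IH|].
    eapply eval_comp1; [apply e_proj|]. apply (e_succ O [x + y]).
Qed.

Lemma Forall2_nth_le a a' i : Forall2 le a a' -> nth i a 0 <= nth i a' 0.
Proof.
  intros H. revert i. induction H; intros [|i]; cbn; auto.
Qed.

Lemma Forall2_le_refl (a : list nat) : Forall2 le a a.
Proof. induction a; constructor; auto. Qed.

Lemma rex_proj k i : rex k (fun _ a => nth i a 0).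
Proof.
  exists (Proj i), (Proj i), (fun a => nth i a 0). repeat split; intros.
  - constructor.
  - now apply Forall2_nth_le.
  - reflexivity.
  - constructor.
Qed.

Lemma rex_zero k : rex k (fun _ _ => 0).
Proof.
  exists Zero, Zero, (fun _ => 0). repeat split; intros; auto; constructor.
Qed.

Lemma rex_succ_hd : rex 1 (fun _ a => S (nth 0 a 0)).
Proof.
  exists Succ, Succ, (fun a => S (nth 0 a 0)). repeat split; intros.
  - rewrite nth_0_hd. constructor.
  - now apply le_n_S, Forall2_nth_le.
  - reflexivity.
  - rewrite nth_0_hd. constructor.
Qed.

Lemma rex_orc_hd : rex 1 (fun D a => Nat.b2n (D (nth 0 a 0))).
Proof.
  exists Orc, Succ, (fun a => S (nth 0 a 0)). repeat split; intros.
  - rewrite nth_0_hd. constructor.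
  - now apply le_n_S, Forall2_nth_le.
  - destruct (D _); cbn; lia.
  - rewrite nth_0_hd in *. apply e_orc, H0. lia.
Qed.

(** [B] bounds the values one by one, while [s] bounds the use of all components together by a
    sum. *)
Lemma rex_list k (Gs : list (real -> list nat -> nat)) :
  Forall (rex k) Gs ->
  exists (gs qs : list prog) (B : list nat -> list nat) (q : prog) (s : list nat -> nat),
    (forall O a, length a = k -> evals O qs a (B a)) /\
    (forall a a', Forall2 le a a' -> Forall2 le (B a) (B a')) /\
    (forall O a, length a = k -> eval O q a (s a)) /\
    (forall a a', Forall2 le a a' -> s a <= s a') /\
    (forall a, length (B a) = length Gs) /\
    (forall D a, length a = k ->
       Forall2 le (map (fun G => G D a) Gs) (B a) /\
       forall O : oracle, (forall i, i < s a -> O i = Some (D i)) ->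
         evals O gs a (map (fun G => G D a) Gs)).
Proof.
  induction 1 as [|G Gs HG HGs IH].
  - exists [], [], (fun _ => []), Zero, (fun _ => 0).
    repeat split; intros; constructor.
  - destruct HG as (p & q & b & Hq & Hm & Hp).
    destruct IH as (gs & qs & B & q' & s & Hqs & HB & Hs & Hsm & Hl & H).
    exists (p :: gs), (q :: qs), (fun a => b a :: B a),
      (Comp add_prog [q; q']), (fun a => b a + s a).
    repeat split; intros.
    + constructor; auto.
    + constructor; auto.
    + eapply eval_comp2; [apply Hq| apply Hs|apply eval_add_prog]; assumption.
    + apply Nat.add_le_mono; auto.
    + cbn. now rewrite Hl.
    + constructor; [now apply Hp | now apply H].
    + constructor; [apply Hp | apply H]; auto; intros; apply H1; lia.
Qed.

(** The inner values are at most [B a], so by monotonicity [b (B a)] bounds the value and the use of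
    the outer functional, and it is computed without the oracle. *)
Lemma rex_comp m k F Gs :
  rex m F -> length Gs = m -> Forall (rex k) Gs ->
  rex k (fun D a => F D (map (fun G => G D a) Gs)).
Proof.
  intros (p & q & b & Hq & Hm & Hp) HL HGs.
  destruct (rex_list k Gs HGs) as (gs & qs & B & q' & s & Hqs & HB & Hs & Hsm & Hl & H).
  exists (Comp p gs), (Comp add_prog [Comp q qs; q']), (fun a => b (B a) + s a).
  repeat split; intros.
  - eapply eval_comp2; [|apply Hs; assumption|apply eval_add_prog].
    econstructor; [now apply Hqs|]. apply Hq. now rewrite Hl.
  - apply Nat.add_le_mono; auto.
  - destruct (Hp D (map (fun G => G D a) Gs)) as [L _]; [now rewrite length_map|].
    destruct (H D a H0) as [L' _]. apply Hm in L'. lia.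
  - destruct (H D a H0) as [L' E].
    econstructor; [apply E; intros; apply H1; lia|].
    apply Hp; [now rewrite length_map|].
    intros i Hi. apply H1. apply Hm in L'. lia.
Qed.

(** The [rex_app] lemmas reduce closure under an operation to the case where its arguments are
    projections. *)
Lemma rex_app1 f : rex 1 (fun D a => f D (nth 0 a 0)) ->
  forall k E1, rex k E1 -> rex k (fun D a => f D (E1 D a)).
Proof.
  intros Hf k E1 H1. apply (rex_comp 1 k _ [E1] Hf); auto.
Qed.

Lemma rex_app2 f : rex 2 (fun D a => f D (nth 0 a 0) (nth 1 a 0)) ->
  forall k E1 E2, rex k E1 -> rex k E2 -> rex k (fun D a => f D (E1 D a) (E2 D a)).
Proof.
  intros Hf k E1 E2 H1 H2. apply (rex_comp 2 k _ [E1; E2] Hf); auto.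
Qed.

Lemma rex_app3 f : rex 3 (fun D a => f D (nth 0 a 0) (nth 1 a 0) (nth 2 a 0)) ->
  forall k E1 E2 E3, rex k E1 -> rex k E2 -> rex k E3 ->
  rex k (fun D a => f D (E1 D a) (E2 D a) (E3 D a)).
Proof.
  intros Hf k E1 E2 E3 H1 H2 H3. apply (rex_comp 3 k _ [E1; E2; E3] Hf); auto.
Qed.

Lemma rex_app4 f :
  rex 4 (fun D a => f D (nth 0 a 0) (nth 1 a 0) (nth 2 a 0) (nth 3 a 0)) ->
  forall k E1 E2 E3 E4, rex k E1 -> rex k E2 -> rex k E3 -> rex k E4 ->
  rex k (fun D a => f D (E1 D a) (E2 D a) (E3 D a) (E4 D a)).
Proof.
  intros Hf k E1 E2 E3 E4 H1 H2 H3 H4.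
  apply (rex_comp 4 k _ [E1; E2; E3; E4] Hf); auto 6.
Qed.

Lemma rex_app5 f :
  rex 5 (fun D a => f D (nth 0 a 0) (nth 1 a 0) (nth 2 a 0) (nth 3 a 0) (nth 4 a 0)) ->
  forall k E1 E2 E3 E4 E5,
  rex k E1 -> rex k E2 -> rex k E3 -> rex k E4 -> rex k E5 ->
  rex k (fun D a => f D (E1 D a) (E2 D a) (E3 D a) (E4 D a) (E5 D a)).
Proof.
  intros Hf k E1 E2 E3 E4 E5 H1 H2 H3 H4 H5.
  apply (rex_comp 5 k _ [E1; E2; E3; E4; E5] Hf); auto 7.
Qed.

Lemma rex_prec k G H :
  rex k G -> rex (S (S k)) H ->
  rex (S k) (fun D a => nat_rect (fun _ => nat) (G D (tl a))
                          (fun y w => H D (y :: w :: tl a)) (nth 0 a 0)).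
Proof.
  intros (p & q & b & Hq & Hm & Hp) (p' & q' & b' & Hq' & Hm' & Hp').
  (* Each stage adds the bound of the step function at the previous bound; the sum dominates the new
     value and the use of all steps so far. *)
  set (B := fun a n => nat_rect (fun _ => nat) (b a) (fun y w => w + b' (y :: w :: a)) n).
  assert (HB : forall a a' n n', Forall2 le a a' -> n <= n' -> B a n <= B a' n').
  { assert (HB1 : forall a a' n, Forall2 le a a' -> B a n <= B a' n).
    { intros a a' n L. induction n as [|n IH]; cbn; [auto|].
      apply Nat.add_le_mono; [exact IH|]. apply Hm'. auto. }
    intros a a' n n' L Ln. transitivity (B a' n); [auto|].
    induction Ln as [|n' _ IH]; [reflexivity|]. cbn. fold (B a' n'). lia. }
  exists (Prec p p'), (Prec q (Comp add_prog [Proj 1; q'])),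
    (fun a => B (tl a) (nth 0 a 0)).
  repeat split.
  - intros O [|n a] L; [discriminate|]. injection L as L. cbn [tl nth].
    induction n as [|n IH]; [constructor; auto|].
    econstructor; [exact IH|]. cbn. fold (B a n).
    eapply eval_comp2; [apply e_proj| apply Hq' |apply eval_add_prog]. cbn. now rewrite L.
  - intros a a' L. apply HB; [destruct L; cbn; auto | now apply Forall2_nth_le].
  - destruct a as [|n a]; [discriminate|]. injection H0 as L. cbn [tl nth].
    induction n as [|n IH]; [now apply Hp|]. cbn. fold (B a n).
    etransitivity; [apply Hp'; cbn; now rewrite L|].
    transitivity (b' (n :: B a n :: a)); [|lia].
    apply Hm'. repeat constructor; auto. apply Forall2_le_refl.
  - destruct a as [|n a]; [discriminate|]. injection H0 as L. cbn [tl nth].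
    intros O.
    set (R := nat_rect (fun _ => nat) (G D a) (fun y w => H D (y :: w :: a))).
    assert (HR : forall n, R n <= B a n).
    { clear n. intros n. induction n as [|n IH]; [now apply Hp|]. cbn. fold (B a n).
      etransitivity; [apply Hp'; cbn; now rewrite L|].
      transitivity (b' (n :: B a n :: a)); [|lia].
      apply Hm'. repeat constructor; auto. apply Forall2_le_refl. }
    intros HO. induction n as [|n IH].
    + constructor. now apply Hp.
    + change (B a (S n)) with (B a n + b' (n :: B a n :: a)) in HO.
      econstructor; [apply IH; intros; apply HO; lia|].
      apply Hp'; [cbn; now rewrite L|].
      intros i Hi. apply HO.
      assert (b' (n :: R n :: a) <= b' (n :: B a n :: a)).
      { apply Hm'. repeat constructor; auto. apply Forall2_le_refl. }
      pose proof (Nat.lt_le_trans _ _ _ Hi H0). lia.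
Qed.

Lemma map_nth_seq (a : list nat) : map (fun i => nth i a 0) (seq 0 (length a)) = a.
Proof.
  induction a as [|x a IH]; cbn; [reflexivity|].
  f_equal. rewrite <- seq_shift, map_map. exact IH.
Qed.

(** [rex_prec] recurses on the first argument. Here the number of steps is any functional, and the
    parameters are passed on through projections. *)
Lemma rex_rec k N G H :
  rex k N -> rex k G ->
  rex (S (S k)) (fun D a => H D (nth 0 a 0) (nth 1 a 0) (tl (tl a))) ->
  rex k (fun D a => nat_rect (fun _ => nat) (G D a) (fun y w => H D y w a) (N D a)).
Proof.
  intros HN HG HH.
  pose proof (rex_prec k _ _ HG HH) as P.
  eapply rex_ext;
    [|apply (rex_comp (S k) k _ (N :: map (fun i _ a => nth i a 0) (seq 0 k)) P)].
  - intros D a L. cbn. rewrite map_map, <- L, map_nth_seq. reflexivity.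
  - cbn. now rewrite length_map, length_seq.
  - constructor; [assumption|]. apply Forall_map, Forall_forall.
    intros i _. apply rex_proj.
Qed.

(** Turns entries of the iterated tails left by [rex_rec] into entries of the original list, so that
    [rex_proj] applies. *)
Lemma rex_tl k i T :
  rex k (fun _ a => nth (S i) (T a) 0) -> rex k (fun _ a => nth i (tl (T a)) 0).
Proof.
  apply rex_ext. intros D a _. destruct (T a); [now destruct i | reflexivity].
Qed.

Lemma rex_S k E : rex k E -> rex k (fun D a => S (E D a)).
Proof. apply (rex_app1 (fun _ => S)), rex_succ_hd. Qed.

Lemma rex_orc k E : rex k E -> rex k (fun D a => Nat.b2n (D (E D a))).
Proof. apply (rex_app1 (fun D x => Nat.b2n (D x))), rex_orc_hd. Qed.

Lemma rex_const k c : rex k (fun _ _ => c).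
Proof. induction c; [apply rex_zero | now apply rex_S]. Qed.

Create HintDb rx discriminated.
Hint Constants Opaque : rx.
Hint Resolve rex_proj rex_tl rex_const rex_S rex_orc rex_rec : rx.
Ltac rx := auto 100 with rx nocore.

Ltac by_ext F := refine (rex_ext _ F _ _ _); [intros D a _ | rx].

Definition cond (c x y : nat) : nat := nat_rect (fun _ => nat) y (fun _ _ => x) c.

Lemma rex_cond k E1 E2 E3 : rex k E1 -> rex k E2 -> rex k E3 ->
  rex k (fun D a => cond (E1 D a) (E2 D a) (E3 D a)).
Proof. apply (rex_app3 (fun _ => cond)). unfold cond. rx. Qed.
Hint Resolve rex_cond : rx.

Lemma rex_if k (C : real -> list nat -> bool) E1 E2 :
  rex k (fun D a => Nat.b2n (C D a)) -> rex k E1 -> rex k E2 ->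
  rex k (fun D a => if C D a then E1 D a else E2 D a).
Proof.
  intros. by_ext (fun D a => cond (Nat.b2n (C D a)) (E1 D a) (E2 D a)).
  now destruct (C D a).
Qed.
Hint Resolve rex_if : rx.

Lemma rex_pred k E : rex k E -> rex k (fun D a => pred (E D a)).
Proof.
  apply (rex_app1 (fun _ => pred)).
  by_ext (fun (_ : real) a => nat_rect (fun _ => nat) 0 (fun y _ => y) (nth 0 a 0)).
  now destruct (nth 0 a 0).
Qed.
Hint Resolve rex_pred : rx.

Lemma rex_add k E1 E2 : rex k E1 -> rex k E2 -> rex k (fun D a => E1 D a + E2 D a).
Proof.
  apply (rex_app2 (fun _ => Nat.add)).
  by_ext (fun (_ : real) a =>
    nat_rect (fun _ => nat) (nth 1 a 0) (fun _ w => S w) (nth 0 a 0)).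
  induction (nth 0 a 0); cbn; auto.
Qed.
Hint Resolve rex_add : rx.

Lemma rex_sub k E1 E2 : rex k E1 -> rex k E2 -> rex k (fun D a => E1 D a - E2 D a).
Proof.
  apply (rex_app2 (fun _ => Nat.sub)).
  by_ext (fun (_ : real) a =>
    nat_rect (fun _ => nat) (nth 0 a 0) (fun _ w => pred w) (nth 1 a 0)).
  induction (nth 1 a 0); cbn [nat_rect]; lia.
Qed.
Hint Resolve rex_sub : rx.

Lemma rex_leb k E1 E2 : rex k E1 -> rex k E2 ->
  rex k (fun D a => Nat.b2n (E1 D a <=? E2 D a)).
Proof.
  intros. by_ext (fun D a => cond (E1 D a - E2 D a) 0 1).
  destruct (Nat.leb_spec (E1 D a) (E2 D a)); cbn.
  - now replace (E1 D a - E2 D a) with 0 by lia.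
  - now destruct (E1 D a - E2 D a) eqn:?; [lia|].
Qed.
Hint Resolve rex_leb : rx.

Lemma rex_ltb k E1 E2 : rex k E1 -> rex k E2 ->
  rex k (fun D a => Nat.b2n (E1 D a <? E2 D a)).
Proof. intros. unfold Nat.ltb. rx. Qed.
Hint Resolve rex_ltb : rx.

Lemma rex_negb k C : rex k (fun D a => Nat.b2n (C D a)) ->
  rex k (fun D a => Nat.b2n (negb (C D a))).
Proof.
  intros. by_ext (fun D a => 1 - Nat.b2n (C D a)). now destruct (C D a).
Qed.

Lemma rex_andb k C C' :
  rex k (fun D a => Nat.b2n (C D a)) -> rex k (fun D a => Nat.b2n (C' D a)) ->
  rex k (fun D a => Nat.b2n (C D a && C' D a)).
Proof.
  intros. by_ext (fun D a => if C D a then Nat.b2n (C' D a) else 0).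
  now destruct (C D a).
Qed.

Lemma rex_orb k C C' :
  rex k (fun D a => Nat.b2n (C D a)) -> rex k (fun D a => Nat.b2n (C' D a)) ->
  rex k (fun D a => Nat.b2n (C D a || C' D a)).
Proof.
  intros. by_ext (fun D a => if C D a then 1 else Nat.b2n (C' D a)).
  now destruct (C D a).
Qed.
Hint Resolve rex_negb rex_andb rex_orb : rx.

Lemma rex_eqb k E1 E2 : rex k E1 -> rex k E2 ->
  rex k (fun D a => Nat.b2n (E1 D a =? E2 D a)).
Proof.
  intros. by_ext (fun D a => Nat.b2n ((E1 D a <=? E2 D a) && (E2 D a <=? E1 D a))).
  destruct (Nat.eqb_spec (E1 D a) (E2 D a)) as [->|].
  - now rewrite Nat.leb_refl.
  - destruct (Nat.leb_spec (E1 D a) (E2 D a)), (Nat.leb_spec (E2 D a) (E1 D a)); cbn; lia.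
Qed.
Hint Resolve rex_eqb : rx.

Lemma rex_pair k E1 E2 : rex k E1 -> rex k E2 ->
  rex k (fun D a => pair (E1 D a) (E2 D a)).
Proof.
  apply (rex_app2 (fun _ => pair)).
  (* Cantor's formula: [y] plus the triangular number of [y + x]. *)
  by_ext (fun (_ : real) a => nth 1 a 0 +
    nat_rect (fun _ => nat) 0 (fun i m => S i + m) (nth 1 a 0 + nth 0 a 0)).
  reflexivity.
Qed.
Hint Resolve rex_pair : rx.

(* The index of the diagonal of Cantor's enumeration on which [n] lies. *)
Definition diagonal (n : nat) : nat :=
  nat_rect (fun _ => nat) 0 (fun i s => if pair 0 s =? i then S s else s) n.

(** The enumeration leaves a diagonal exactly after its last point, whose code is [pair 0 s]; every
    other step preserves the sum of the coordinates. *)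
Lemma diagonal_spec n : diagonal n = p1 n + p2 n.
Proof.
  induction n as [|n IH]; [now rewrite p1_0, p2_0|].
  change (diagonal (S n)) with
    (if pair 0 (diagonal n) =? n then S (diagonal n) else diagonal n).
  rewrite IH.
  assert (E : (p1 (S n), p2 (S n)) =
    match p1 n with S x => (x, S (p2 n)) | 0 => (S (p2 n), 0) end).
  { rewrite <- of_nat_p. change (Cantor.of_nat (S n)) with
      ((fun '(x, y) => match x with S x => (x, S y) | _ => (S y, 0) end) (Cantor.of_nat n)).
    rewrite of_nat_p. now destruct (p1 n). }
  destruct (Nat.eqb_spec (pair 0 (p1 n + p2 n)) n) as [H|H].
  - apply (f_equal p1) in H as H'. rewrite p1_pair in H'. rewrite <- H' in *.
    injection E as -> ->. lia.
  - destruct (p1 n) as [|x] eqn:X.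
    + elim H. cbn. rewrite <- X. apply pair_p.
    + injection E as -> ->. lia.
Qed.

Lemma rex_p2 k E : rex k E -> rex k (fun D a => p2 (E D a)).
Proof.
  apply (rex_app1 (fun _ => p2)).
  (* Diagonal [s] begins at the code [pair s 0], and the second coordinate counts the steps from
     there. *)
  by_ext (fun (_ : real) a => nth 0 a 0 - (pair (diagonal (nth 0 a 0)) 0)).
  - rewrite diagonal_spec. set (n := nth 0 a 0).
    rewrite <- (pair_p n) at 1.
    change (p2 n + nat_rect (fun _ => nat) 0 (fun i m => S i + m) (p2 n + p1 n)
      - nat_rect (fun _ => nat) 0 (fun i m => S i + m) (p1 n + p2 n) = p2 n).
    rewrite (Nat.add_comm (p1 n)). lia.
  - unfold diagonal. rx.
Qed.
Hint Resolve rex_p2 : rx.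

Lemma rex_p1 k E : rex k E -> rex k (fun D a => p1 (E D a)).
Proof.
  apply (rex_app1 (fun _ => p1)).
  by_ext (fun (_ : real) a => diagonal (nth 0 a 0) - p2 (nth 0 a 0)).
  - rewrite diagonal_spec. lia.
  - unfold diagonal. rx.
Qed.
Hint Resolve rex_p1 : rx.

Lemma rex_consn k E1 E2 : rex k E1 -> rex k E2 ->
  rex k (fun D a => consn (E1 D a) (E2 D a)).
Proof. unfold consn. rx. Qed.

Lemma rex_hdn k E : rex k E -> rex k (fun D a => hdn (E D a)).
Proof. unfold hdn. rx. Qed.

Lemma rex_tln k E : rex k E -> rex k (fun D a => tln (E D a)).
Proof. unfold tln. rx. Qed.
Hint Resolve rex_consn rex_hdn rex_tln : rx.

Lemma rex_odd k E : rex k E -> rex k (fun D a => Nat.b2n (Nat.odd (E D a))).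
Proof.
  apply (rex_app1 (fun _ x => Nat.b2n (Nat.odd x))).
  by_ext (fun (_ : real) a => nat_rect (fun _ => nat) 0 (fun _ w => 1 - w) (nth 0 a 0)).
  induction (nth 0 a 0) as [|n IH]; [reflexivity|].
  cbn [nat_rect]. rewrite IH, Nat.odd_succ, <- Nat.negb_odd. now destruct (Nat.odd n).
Qed.
Hint Resolve rex_odd : rx.

Lemma rex_even k E : rex k E -> rex k (fun D a => Nat.b2n (Nat.even (E D a))).
Proof.
  intros. by_ext (fun D a => Nat.b2n (negb (Nat.odd (E D a)))). now rewrite Nat.negb_odd.
Qed.
Hint Resolve rex_even : rx.

Lemma rex_div2 k E : rex k E -> rex k (fun D a => Nat.div2 (E D a)).
Proof.
  apply (rex_app1 (fun _ => Nat.div2)).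
  by_ext (fun (_ : real) a => nat_rect (fun _ => nat) 0
    (fun y w => if Nat.odd y then S w else w) (nth 0 a 0)).
  induction (nth 0 a 0) as [|n IH]; [reflexivity|].
  cbn [nat_rect]. rewrite IH.
  pose proof (Nat.div2_odd n). pose proof (Nat.div2_odd (S n)).
  rewrite Nat.odd_succ, <- Nat.negb_odd in H0.
  destruct (Nat.odd n); cbn [Nat.b2n negb] in *; lia.
Qed.
Hint Resolve rex_div2 : rx.

(** * Truth-table reducibility *)

Lemma tt_le_rex C D F :
  rex 1 F -> (forall n, F D [n] = Nat.b2n (C n)) -> tt_le C D.
Proof.
  intros (p & q & b & Hq & Hm & Hp) E. exists p. split.
  - exists (fun n => b [n]). split.
    + exists q. intros n. now apply Hq.
    (* The string has length [b [n]], so the real obtained by padding it with [false] agrees with it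
       on the whole use. *)
    + intros n s L. exists (F (fun i => nth i s false) [n]).
      apply Hp; [reflexivity|]. intros i Hi.
      unfold string_oracle. rewrite nth_error_nth' with (d := false); [reflexivity | lia].
  - intros n. change (if C n then 1 else 0) with (Nat.b2n (C n)).
    rewrite <- E. now apply Hp.
Qed.

Lemma tt_le_refl A : tt_le A A.
Proof.
  apply (tt_le_rex _ _ (fun D a => Nat.b2n (D (nth 0 a 0)))); [rx | reflexivity].
Qed.

(** In a composed reduction [f n] bounds the outer queries, and the sum is at least the use [g i] of
    answering each of them. *)
Lemma computable_sum f g : computable f -> computable g ->
  computable (fun n => nat_rect (fun _ => nat) 0 (fun i w => w + g i) (f n)).
Proof.
  intros [pf Hf] [pg Hg].
  exists (Comp (Prec Zero (Comp add_prog [Proj 1; Comp pg [Proj 0]])) [pf]).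
  intros n. eapply eval_comp1; [apply Hf|].
  induction (f n) as [|m IH]; cbn; [repeat constructor|].
  econstructor; [exact IH|].
  eapply eval_comp2; [apply e_proj | | apply eval_add_prog].
  eapply eval_comp1; [apply e_proj | apply Hg].
Qed.

Lemma sum_upper g m i : i < m ->
  g i <= nat_rect (fun _ => nat) 0 (fun i w => w + g i) m.
Proof.
  induction m as [|m IH]; cbn; [lia|]. intros L.
  destruct (Nat.eq_dec i m) as [->|]; [lia|]. specialize (IH ltac:(lia)). lia.
Qed.

Lemma converges_longer p (s s' : list bool) n :
  length s <= length s' -> (forall t, length t = length s -> converges p (string_oracle t) n) ->
  converges p (string_oracle s') n.
Proof.
  intros L H.
  destruct (H (firstn (length s) s')) as [v E]; [rewrite length_firstn; lia|].
  exists v. revert E. apply eval_mono. unfold string_oracle. intros i b.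
  rewrite nth_error_firstn. now destruct (Nat.ltb_spec i (length s)).
Qed.

(** On a string that is no initial segment of the intended oracle, a reduction may output numbers
    above 1. Taking the sign makes every output usable as an oracle answer. *)
Definition sign_prog : prog := Prec Zero (Comp Succ [Zero]).

Lemma eval_sign_prog O x : eval O sign_prog [x] (Nat.b2n (0 <? x)).
Proof.
  assert (H : eval O sign_prog [x] (match x with 0 => 0 | S _ => 1 end)).
  { induction x; econstructor; [constructor | eassumption |].
    eapply eval_comp1; [constructor|]. apply (e_succ O [0]). }
  now destruct x.
Qed.

Lemma tt_le_trans B A C : tt_le A B -> tt_le B C -> tt_le A C.
Proof.
  intros (p & (f & Cf & Hp) & Ep) (q & (g & Cg & Hq) & Eq).
  exists (subst_orc (Comp sign_prog [q]) p). split.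
  - exists (fun n => nat_rect (fun _ => nat) 0 (fun i w => w + g i) (f n)).
    split; [now apply computable_sum|]. intros n s L.
    (* The string [t] collects the answers of the inner reduction on [s]. At length [f n] the outer
       reduction converges on it. *)
    assert (H : forall m, m <= f n -> exists t : list bool, length t = m /\
      forall i, i < m ->
        eval (string_oracle s) (Comp sign_prog [q]) [i] (Nat.b2n (nth i t false))).
    { induction m as [|m IH]; intros Hm; [now exists []|].
      destruct IH as (t & Ht & Hi); [lia|].
      destruct (converges_longer q (repeat false (g m)) s m) as [v Ev].
      - rewrite repeat_length, L. now apply sum_upper.
      - intros t'. rewrite repeat_length. apply Hq.
      - exists (t ++ [0 <? v]). rewrite length_app. split; [cbn; lia|].
        intros i Li. destruct (Nat.eq_dec i m) as [->|].
        + rewrite app_nth2, Ht, Nat.sub_diag by lia. cbn [nth].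
          eapply eval_comp1; [exact Ev | apply eval_sign_prog].
        + rewrite app_nth1 by lia. apply Hi. lia. }
    destruct (H (f n)) as (t & Ht & Hi); [lia|].
    destruct (Hp n t Ht) as [v Ev]. exists v. revert Ev.
    apply eval_subst_orc. unfold string_oracle. intros i b Eb.
    assert (i < length t) by (apply nth_error_Some; congruence).
    rewrite nth_error_nth' with (d := false) in Eb by assumption.
    injection Eb as <-. apply Hi. lia.
  - intros n. eapply eval_subst_orc; [|apply Ep].
    intros i b [= <-]. eapply eval_comp1; [apply Eq|].
    pose proof (eval_sign_prog (real_oracle C) (if B i then 1 else 0)) as E.
    now destruct (B i).
Qed.

Lemma join_double A B n : join A B (n + n) = A n.
Proof.
  unfold join. replace (n + n) with (2 * n) by lia.
  now rewrite Nat.even_even, Nat.div2_double.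
Qed.

Lemma join_double_S A B n : join A B (S (n + n)) = B n.
Proof.
  unfold join. replace (S (n + n)) with (S (2 * n)) by lia.
  now rewrite Nat.div2_succ_double, Nat.even_succ, Nat.odd_even.
Qed.

Lemma tt_le_join_l A B : tt_le A (join A B).
Proof.
  apply (tt_le_rex _ _ (fun D a => Nat.b2n (D (nth 0 a 0 + nth 0 a 0)))).
  - rx.
  - intros n. cbn [nth]. now rewrite join_double.
Qed.

Lemma tt_le_join_r A B : tt_le B (join A B).
Proof.
  apply (tt_le_rex _ _ (fun D a => Nat.b2n (D (S (nth 0 a 0 + nth 0 a 0))))).
  - rx.
  - intros n. cbn [nth]. now rewrite join_double_S.
Qed.

(** Replacing each query by [Zero] simulates the all-false oracle, so one program works over every
    [O], partial oracles included. *)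
Lemma rex_oracle_free k F : rex k F ->
  exists p, forall O a, length a = k -> eval O p a (F (fun _ => false) a).
Proof.
  intros (p & q & b & Hq & Hm & Hp). exists (subst_orc Zero p). intros O a L.
  apply (eval_subst_orc (real_oracle (fun _ => false))).
  - intros i c [= <-]. constructor.
  - now apply Hp.
Qed.

(** Both reductions are run on half of the input and parity selects the result; the use is therefore
    bounded by the sum of the two bounds. *)
Lemma tt_le_join A B C : tt_le A C -> tt_le B C -> tt_le (join A B) C.
Proof.
  intros (p & (f & [pf Cf] & Hp) & Ep) (q & (g & [pg Cg] & Hq) & Eq).
  destruct (rex_oracle_free 1 (fun _ a => Nat.div2 (nth 0 a 0))) as [half Hh]; [rx|].
  destruct (rex_oracle_free 3 (fun _ a => if Nat.even (nth 0 a 0) then nth 1 a 0 else nth 2 a 0))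
    as [sel Hs]; [rx|].
  assert (E : forall O n x y, eval O p [Nat.div2 n] x -> eval O q [Nat.div2 n] y ->
    eval O (Comp sel [Proj 0; Comp p [half]; Comp q [half]]) [n]
      (if Nat.even n then x else y)).
  { intros O n x y Ex Ey. econstructor; [|now apply (Hs O [n; x; y])].
    repeat constructor.
    - eapply eval_comp1; [now apply Hh | exact Ex].
    - eapply eval_comp1; [now apply Hh | exact Ey]. }
  exists (Comp sel [Proj 0; Comp p [half]; Comp q [half]]). split.
  - exists (fun n => f (Nat.div2 n) + g (Nat.div2 n)). split.
    + exists (Comp add_prog [Comp pf [half]; Comp pg [half]]). intros n.
      eapply eval_comp2; [| |apply eval_add_prog];
        (eapply eval_comp1; [now apply Hh|]); [apply Cf | apply Cg].
    + intros n s L.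
      destruct (converges_longer p (repeat false (f (Nat.div2 n))) s (Nat.div2 n)) as [x Ex].
      { rewrite repeat_length. lia. }
      { intros t. rewrite repeat_length. apply Hp. }
      destruct (converges_longer q (repeat false (g (Nat.div2 n))) s (Nat.div2 n)) as [y Ey].
      { rewrite repeat_length. lia. }
      { intros t. rewrite repeat_length. apply Hq. }
      eexists. apply E; eassumption.
  - intros n. specialize (E _ n _ _ (Ep _) (Eq _)). unfold join.
    now destruct (Nat.even n).
Qed.

(** * A universal machine *)

(* States of a continuation machine on codes: evaluate the program [c] (resp. the
   program list [g]) on the argument list [a], or return [x]; [K] is a list of frames
   [pair tag data] with tag
     0: evaluate the remaining programs of a list,   1: cons onto a returned list,
     2: apply a program to a returned list,          3: step of a primitive recursion,
     4: test of a minimisation. *)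
Definition state (mode x y K : nat) : nat := pair mode (pair x (pair y K)).
Definition ret (x K : nat) : nat := state 0 x 0 K.
Definition ev (c a K : nat) : nat := state 1 c a K.
Definition evs (g a K : nat) : nat := state 2 g a K.

Definition nthn (i l : nat) : nat :=
  hdn (nat_rect (fun _ => nat) l (fun _ w => tln w) i).

(** Frame data: for tag 0 the remaining list and the arguments, for 1 the head, for 2 the program,
    for 3 the step program with counter and parameters, for 4 the tested program with the current
    candidate and the arguments. *)
Definition step_frame (x t d K : nat) : nat :=
  if t =? 0 then evs (p1 d) (p2 d) (consn (pair 1 x) K)
  else if t =? 1 then ret (consn d x) K
  else if t =? 2 then ev d x K
  else if t =? 3 then ev (p1 d) (consn (p1 (p2 d)) (consn x (p2 (p2 d)))) K
  else if x =? 0 then ret (p1 (p2 d)) K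
  else ev (p1 d) (consn (S (p1 (p2 d))) (p2 (p2 d)))
         (consn (pair 4 (pair (p1 d) (pair (S (p1 (p2 d))) (p2 (p2 d))))) K).

Definition step_ret (x K : nat) : nat :=
  if K =? 0 then ret x 0 else step_frame x (p1 (hdn K)) (p2 (hdn K)) (tln K).

(* [ans] is the answer to the query [hdn a]: 0 if undefined, [S b] for the bit [b]. *)
Definition step_ev (ans c a K : nat) : nat :=
  if p1 c =? 0 then ret 0 K
  else if p1 c =? 1 then ret (S (hdn a)) K
  else if p1 c =? 2 then ret (nthn (p2 c) a) K
  else if p1 c =? 3 then if ans =? 0 then ev c a K else ret (pred ans) K
  else if p1 c =? 4 then evs (p2 (p2 c)) a (consn (pair 2 (p1 (p2 c))) K)
  else if p1 c =? 5 then
    if a =? 0 then ev c a K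
    else if hdn a =? 0 then ev (p1 (p2 c)) (tln a) K
    else ev c (consn (pred (hdn a)) (tln a))
           (consn (pair 3 (pair (p2 (p2 c)) (pair (pred (hdn a)) (tln a)))) K)
  else ev (p2 c) (consn 0 a) (consn (pair 4 (pair (p2 c) (pair 0 a))) K).

Definition step_evs (g a K : nat) : nat :=
  if g =? 0 then ret 0 K
  else ev (hdn g) a (consn (pair 0 (pair (tln g) a)) K).

Definition step (o : nat -> nat) (s : nat) : nat :=
  if p1 s =? 0 then step_ret (p1 (p2 s)) (p2 (p2 (p2 s)))
  else if p1 s =? 1 then
    step_ev (o (hdn (p1 (p2 (p2 s))))) (p1 (p2 s)) (p1 (p2 (p2 s))) (p2 (p2 (p2 s)))
  else step_evs (p1 (p2 s)) (p1 (p2 (p2 s))) (p2 (p2 (p2 s))).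

Definition run (o : nat -> nat) (n s : nat) : nat :=
  nat_rect (fun _ => nat) s (fun _ w => step o w) n.

Definition halted (s : nat) : bool := (p1 s =? 0) && (p2 (p2 (p2 s)) =? 0).
Definition output (s : nat) : nat := p1 (p2 s).

Ltac proj := rewrite ?p1_pair, ?p2_pair, ?p1_pair, ?p2_pair, ?p1_pair, ?p2_pair,
  ?p1_pair, ?p2_pair.

Lemma step_of_ret o x K : step o (ret x K) = step_ret x K.
Proof. unfold step, ret, state. now proj. Qed.

Lemma step_of_ev o c a K : step o (ev c a K) = step_ev (o (hdn a)) c a K.
Proof. unfold step, ev, state. now proj. Qed.

Lemma step_of_evs o g a K : step o (evs g a K) = step_evs g a K.
Proof. unfold step, evs, state. now proj. Qed.

Lemma step_of_frame o x t d K :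
  step o (ret x (consn (pair t d) K)) = step_frame x t d K.
Proof.
  rewrite step_of_ret. unfold step_ret. rewrite hdn_cons, tln_cons. proj. reflexivity.
Qed.

Lemma run_S o n s : run o (S n) s = run o n (step o s).
Proof.
  induction n as [|n IH]; [reflexivity|].
  change (step o (run o (S n) s) = step o (run o n (step o s))). now rewrite IH.
Qed.

Lemma run_add o n m s : run o (n + m) s = run o m (run o n s).
Proof.
  revert s. induction n as [|n IH]; intros s; [reflexivity|].
  cbn [Nat.add]. now rewrite !run_S, IH.
Qed.

Lemma halted_ret x : halted (ret x 0) = true.
Proof. unfold halted, ret, state. now proj. Qed.

Lemma output_ret x K : output (ret x K) = x.
Proof. unfold output, ret, state. now proj. Qed.

Lemma nthn_S i l : nthn (S i) l = nthn i (tln l).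
Proof.
  unfold nthn. f_equal.
  induction i as [|i IH]; [reflexivity|]. cbn [nat_rect] in *. now rewrite IH.
Qed.

Lemma nthn_enc i l : nthn i (enc l) = nth i l 0.
Proof.
  revert l. induction i as [|i IH]; intros l.
  - unfold nthn. cbn [nat_rect]. now rewrite hdn_enc, nth_0_hd.
  - rewrite nthn_S, tln_enc, IH. destruct l; [now destruct i | reflexivity].
Qed.

Definition answers (O : oracle) (q : nat) : nat :=
  match O q with None => 0 | Some b => S (Nat.b2n b) end.

Definition reaches (o : nat -> nat) (s t : nat) : Prop := exists n, run o n s = t.

Lemma reaches_refl o s : reaches o s s.
Proof. now exists 0. Qed.

Lemma reaches_step o s u t : step o s = u -> reaches o u t -> reaches o s t.
Proof. intros <- [n E]. exists (S n). now rewrite run_S. Qed.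

Lemma reaches_trans o s u t : reaches o s u -> reaches o u t -> reaches o s t.
Proof. intros [n <-] [m <-]. exists (n + m). apply run_add. Qed.

Lemma decode_cases c (R : prog -> Prop) :
  (p1 c = 0 -> R Zero) ->
  (p1 c = 1 -> R Succ) ->
  (p1 c = 2 -> R (Proj (p2 c))) ->
  (p1 c = 3 -> R Orc) ->
  (p1 c = 4 -> R (Comp (decode (p1 (p2 c))) (decodel (p2 (p2 c))))) ->
  (p1 c = 5 -> R (Prec (decode (p1 (p2 c))) (decode (p2 (p2 c))))) ->
  (5 < p1 c -> R (Mu (decode (p2 c)))) ->
  R (decode c).
Proof.
  intros. rewrite decode_eq.
  destruct (p1 c) as [|[|[|[|[|[|t]]]]]]; auto. apply H5. lia.
Qed.

Ltac step_ev_tag H := rewrite step_of_ev; unfold step_ev; rewrite H; cbn [Nat.eqb].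
Ltac step_frame_tag := rewrite step_of_frame; unfold step_frame; cbn [Nat.eqb]; proj.

Lemma step_mu o c a K : 5 < p1 c ->
  step o (ev c a K) = ev (p2 c) (consn 0 a) (consn (pair 4 (pair (p2 c) (pair 0 a))) K).
Proof.
  intros H. rewrite step_of_ev. unfold step_ev.
  now destruct (p1 c) as [|[|[|[|[|[|t]]]]]]; try lia.
Qed.

(** Completeness of the machine. Since the stack [K] is arbitrary, runs of subprograms can be
    chained inside the run of the whole program. *)
Lemma reaches_eval O p a v : eval O p a v ->
  forall c K, decode c = p -> reaches (answers O) (ev c (enc a) K) (ret v K).
Proof.
  revert p a v.
  apply (eval_induction O
    (fun p a v => forall c K, decode c = p ->
       reaches (answers O) (ev c (enc a) K) (ret v K))
    (fun gs a ys => forall g K, decodel g = gs ->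
       reaches (answers O) (evs g (enc a) K) (ret (enc ys) K))).
  - intros a c K. apply decode_cases; try discriminate. intros T _.
    eapply reaches_step; [step_ev_tag T; reflexivity|]. apply reaches_refl.
  - intros a c K. apply decode_cases; try discriminate. intros T _.
    eapply reaches_step; [step_ev_tag T; reflexivity|].
    rewrite hdn_enc. apply reaches_refl.
  - intros i a c K. apply decode_cases; try discriminate. intros T [= <-].
    eapply reaches_step; [step_ev_tag T; reflexivity|].
    rewrite nthn_enc. apply reaches_refl.
  - intros a b Hb c K. apply decode_cases; try discriminate. intros T _.
    eapply reaches_step; [step_ev_tag T; rewrite hdn_enc; unfold answers; rewrite Hb;
      cbn [Nat.eqb pred]; reflexivity|].
    apply reaches_refl.
  - intros f gs a ys v IHs IH c K. apply decode_cases; try discriminate.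
    intros T [= <- <-].
    eapply reaches_step; [step_ev_tag T; reflexivity|].
    eapply reaches_trans; [now apply IHs|].
    eapply reaches_step; [step_frame_tag; reflexivity|]. now apply IH.
  - intros g h r v IH c K. apply decode_cases; try discriminate.
    intros T [= <- <-].
    eapply reaches_step; [step_ev_tag T; rewrite hdn_enc, tln_enc; cbn; reflexivity|].
    now apply IH.
  - intros g h y r w v IHw IH c K.
    (* The equation for [decode c] is kept because the recursive call runs the same code [c]
       again. *)
    generalize (eq_refl (decode c)). apply (decode_cases c (fun p => decode c = p -> p = _ -> _));
      try discriminate.
    intros T E [= <- <-].
    eapply reaches_step.
    { step_ev_tag T. rewrite hdn_enc, tln_enc. cbn [enc tl hd]. cbn [pred Nat.eqb consn].
      reflexivity. }
    eapply reaches_trans; [apply (IHw c); assumption|].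
    eapply reaches_step; [step_frame_tag; reflexivity|].
    now apply (IH (p2 (p2 c))).
  - intros f a v IH N c K. apply decode_cases; try discriminate.
    intros T [= Ef].
    eapply reaches_step; [now apply step_mu|].
    (* The search arrives at the test of each candidate up to [v], because all smaller candidates
       give nonzero values. *)
    assert (L : forall i, i <= v -> reaches (answers O)
        (ev (p2 c) (consn 0 (enc a)) (consn (pair 4 (pair (p2 c) (pair 0 (enc a)))) K))
        (ev (p2 c) (consn i (enc a)) (consn (pair 4 (pair (p2 c) (pair i (enc a)))) K))).
    { induction i as [|i IHi]; intros Li; [apply reaches_refl|].
      eapply reaches_trans; [apply IHi; lia|].
      destruct (N i) as (w & Hw & IHw); [lia|].
      eapply reaches_trans; [now apply (IHw (p2 c))|].
      eapply reaches_step; [step_frame_tag; reflexivity|].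
      rewrite (proj2 (Nat.eqb_neq w 0) Hw). apply reaches_refl. }
    eapply reaches_trans; [now apply (L v)|].
    eapply reaches_trans; [now apply (IH (p2 c))|].
    eapply reaches_step; [step_frame_tag; reflexivity|]. apply reaches_refl.
  - intros a g K E. rewrite decodel_eq in E. destruct g; [|discriminate].
    eapply reaches_step; [apply step_of_evs|]. apply reaches_refl.
  - intros p ps a y ys IH IHs g K E. rewrite decodel_eq in E.
    destruct g as [|g]; [discriminate|]. injection E as E1 E2.
    eapply reaches_step; [apply step_of_evs|].
    eapply reaches_trans; [now apply IH|].
    eapply reaches_step; [step_frame_tag; reflexivity|].
    eapply reaches_trans; [now apply IHs|].
    eapply reaches_step; [step_frame_tag; reflexivity|]. apply reaches_refl.
Qed.

(** Soundness of the machine, by induction on the length of the run. A halting run must first return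
    a value to [K], and the rest is a strictly shorter halting run; when [K] holds the continuation
    of a larger program, the induction applies to that rest. *)
Lemma eval_of_halted O n : forall K a,
  (forall c, halted (run (answers O) n (ev c (enc a) K)) = true ->
     exists v m, m < n /\ eval O (decode c) a v /\
       halted (run (answers O) m (ret v K)) = true) /\
  (forall g, halted (run (answers O) n (evs g (enc a) K)) = true ->
     exists ys m, m < n /\ evals O (decodel g) a ys /\
       halted (run (answers O) m (ret (enc ys) K)) = true).
Proof.
  induction n as [n IH] using lt_wf_ind. intros K a.
  destruct n as [|n].
  { split; intros ?; unfold halted, run, ev, evs, state; cbn [nat_rect]; proj; discriminate. }
  assert (IHev : forall m, m <= n -> forall c a K,
      halted (run (answers O) m (ev c (enc a) K)) = true ->
      exists v m', m' < m /\ eval O (decode c) a v /\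
        halted (run (answers O) m' (ret v K)) = true).
  { intros m L c a' K'. apply IH. lia. }
  assert (IHevs : forall m, m <= n -> forall g a K,
      halted (run (answers O) m (evs g (enc a) K)) = true ->
      exists ys m', m' < m /\ evals O (decodel g) a ys /\
        halted (run (answers O) m' (ret (enc ys) K)) = true).
  { intros m L c a' K'. apply IH. lia. }
  (* Returning to a nonempty stack is not final, so at least one step remains. *)
  assert (Fr : forall m x t d K, halted (run (answers O) m (ret x (consn (pair t d) K))) = true ->
      exists m', m = S m' /\ halted (run (answers O) m' (step_frame x t d K)) = true).
  { intros [|m] x t d K' H.
    - unfold halted, run, ret, state in H. cbn [nat_rect] in H. revert H. proj. discriminate.
    - exists m. split; [reflexivity|]. now rewrite run_S, step_of_frame in H. }
  split.
  - intros c. rewrite run_S. apply decode_cases; intros T.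
    + step_ev_tag T. intros H. exists 0, n. repeat split; auto; constructor.
    + step_ev_tag T. rewrite hdn_enc. intros H. eexists _, n.
      repeat split; [|constructor|exact H]. lia.
    + step_ev_tag T. rewrite nthn_enc. intros H. eexists _, n.
      repeat split; [|constructor|exact H]. lia.
    + step_ev_tag T. rewrite hdn_enc.
      assert (Ea : answers O (hd 0 a) =
        match O (hd 0 a) with None => 0 | Some b => S (Nat.b2n b) end) by reflexivity.
      rewrite Ea. clear Ea.
      destruct (O (hd 0 a)) as [b|] eqn:Eb; cbn [Nat.eqb pred]; intros H.
      * exists (Nat.b2n b), n. repeat split; [lia| |exact H]. now constructor.
      (* An unanswered query leaves the state unchanged, so the same state halts in fewer steps. *)
      * apply IHev in H; [|lia]. destruct H as (v & m & L & E & H).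
        exists v, m. repeat split; [lia| |exact H].
        revert E. rewrite decode_eq, T. auto.
    + step_ev_tag T. intros H.
      apply IHevs in H; [|lia]. destruct H as (ys & m & L & E & H).
      apply Fr in H as (m' & -> & H). unfold step_frame in H. cbn [Nat.eqb] in H.
      apply IHev in H; [|lia]. destruct H as (v & m & L' & E' & H).
      exists v, m. repeat split; [lia| |exact H]. econstructor; eassumption.
    + step_ev_tag T. rewrite hdn_enc, tln_enc. destruct a as [|y r]; cbn [enc tl hd].
      (* Primitive recursion on the empty argument list has no rule in [eval]; the machine likewise
         repeats its state. *)
      * cbn [Nat.eqb]. intros H. change 0 with (enc []) in H.
        apply IHev in H; [|lia]. destruct H as (v & m & L & E & H).
        exists v, m. repeat split; [lia| |exact H].
        revert E. rewrite decode_eq, T. auto.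
      * change (consn y (enc r) =? 0) with false. cbv iota.
        destruct y as [|y]; cbn [Nat.eqb pred]; intros H.
        -- apply IHev in H; [|lia]. destruct H as (v & m & L & E & H).
           exists v, m. repeat split; [lia| |exact H]. now constructor.
        -- change (consn y (enc r)) with (enc (y :: r)) in H.
           apply IHev in H; [|lia]. destruct H as (w & m & L & E & H).
           apply Fr in H as (m' & -> & H). unfold step_frame in H. cbn [Nat.eqb] in H.
           rewrite ?p1_pair, ?p2_pair, ?p1_pair, ?p2_pair in H.
           change (consn y (consn w (enc r))) with (enc (y :: w :: r)) in H.
           apply IHev in H; [|lia]. destruct H as (v & m & L' & E' & H).
           exists v, m. repeat split; [lia| |exact H].
           rewrite decode_eq, T in E. econstructor; eassumption.
    + rewrite step_mu by assumption.
      (* Induction along the rest of the run: every nonzero test moves the candidate from [i] to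
         [S i]. *)
      assert (Loop : forall m, m <= n -> forall i,
        (forall y, y < i -> exists w, w <> 0 /\ eval O (decode (p2 c)) (y :: a) w) ->
        halted (run (answers O) m (ev (p2 c) (enc (i :: a))
           (consn (pair 4 (pair (p2 c) (pair i (enc a)))) K))) = true ->
        exists v m', m' < S n /\ eval O (Mu (decode (p2 c))) a v /\
          halted (run (answers O) m' (ret v K)) = true).
      { induction m as [m IHm] using lt_wf_ind. intros Lm i Hi H.
        apply IHev in H; [|lia]. destruct H as (w & m' & L & E & H).
        apply Fr in H as (m'' & -> & H). unfold step_frame in H. cbn [Nat.eqb] in H.
        rewrite ?p1_pair, ?p2_pair, ?p1_pair, ?p2_pair, ?p1_pair, ?p2_pair in H.
        destruct (Nat.eqb_spec w 0) as [->|Hw].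
        - exists i, m''. repeat split; [lia| |exact H]. now constructor.
        - change (consn (S i) (enc a)) with (enc (S i :: a)) in H.
          apply IHm in H; auto; try lia.
          intros y Ly. destruct (Nat.eq_dec y i) as [->|]; [eauto|]. apply Hi. lia. }
      apply (Loop n); lia.
  - intros g. rewrite run_S, step_of_evs, decodel_eq. unfold step_evs.
    destruct g as [|g]; cbn [Nat.eqb]; intros H.
    + exists [], n. repeat split; [lia| constructor |exact H].
    + apply IHev in H; [|lia]. destruct H as (y & m & L & E & H).
      apply Fr in H as (m' & -> & H). unfold step_frame in H. cbn [Nat.eqb] in H.
      rewrite ?p1_pair, ?p2_pair in H.
      apply IHevs in H; [|lia]. destruct H as (ys & m & L' & E' & H).
      apply Fr in H as (m'' & -> & H). unfold step_frame in H. cbn [Nat.eqb] in H.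
      exists (y :: ys), m''. repeat split; [lia| constructor; assumption |exact H].
Qed.

(** Each step consults the oracle at a single position, so [n] steps consult finitely many. *)
Lemma run_use o n s : exists u, forall o', (forall q, q < u -> o' q = o q) ->
  run o' n s = run o n s.
Proof.
  induction n as [|n [u IH]]; [now exists 0|].
  set (w := run o n s) in *.
  exists (u + S (hdn (p1 (p2 (p2 w))))). intros o' Ho.
  change (step o' (run o' n s) = step o w).
  rewrite IH by (intros; apply Ho; lia). unfold step. now rewrite Ho by lia.
Qed.

Lemma halted_run_le o n m s : n <= m -> halted (run o n s) = true ->
  halted (run o m s) = true /\ output (run o m s) = output (run o n s).
Proof.
  intros L H. induction L as [|m L [IH <-]]; [easy|].
  change (run o (S m) s) with (step o (run o m s)).
  set (w := run o m s) in *. apply andb_prop in IH as [H1 H2].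
  unfold step. rewrite H1. unfold step_ret. rewrite H2.
  now rewrite halted_ret, output_ret.
Qed.

(** * The classes [P_h] *)

Definition bex (f : nat -> bool) (n : nat) : bool :=
  nat_rect (fun _ => bool) false (fun y w => w || f y) n.

Lemma bex_spec f n : bex f n = true <-> exists i, i < n /\ f i = true.
Proof.
  induction n as [|n IH]; cbn; [split; [discriminate | intros (i & L & _); lia]|].
  fold (bex f n). rewrite orb_true_iff, IH. split.
  - intros [(i & L & H)|H]; [exists i | exists n]; split; auto; lia.
  - intros (i & L & H). destruct (Nat.eq_dec i n) as [->|]; [auto|].
    left. exists i. split; auto; lia.
Qed.

Lemma bex_ext f g n : (forall i, i < n -> f i = g i) -> bex f n = bex g n.
Proof.
  intros H. induction n as [|n IH]; cbn; [reflexivity|].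
  fold (bex f n) (bex g n). rewrite IH, H; auto.
Qed.

(* Quantification over the strings of length [m], for [f] depending on bits below [m]. *)
Definition ball (m : nat) (f : real -> bool) : bool :=
  negb (bex (fun s => negb (f (Nat.testbit s))) (2 ^ m)).

Lemma string_number m (z : real) :
  exists s, s < 2 ^ m /\ forall i, i < m -> Nat.testbit s i = z i.
Proof.
  revert z. induction m as [|m IH]; intros z; [exists 0; split; [cbn; lia | lia]|].
  destruct (IH (fun i => z (S i))) as (s & L & H).
  exists (2 * s + Nat.b2n (z 0)). split.
  - cbn [Nat.pow]. destruct (z 0); cbn [Nat.b2n]; lia.
  - intros [|i] Li; [apply Nat.testbit_0_r|].
    rewrite Nat.testbit_succ_r. apply H. lia.
Qed.

Lemma ball_spec m f :
  (forall z z', (forall i, i < m -> z i = z' i) -> f z = f z') ->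
  ball m f = true <-> forall z, f z = true.
Proof.
  intros Hf. unfold ball. rewrite negb_true_iff, <- not_true_iff_false, bex_spec. split.
  - intros H z. apply not_false_iff_true. intros E. apply H.
    destruct (string_number m z) as (s & L & Hs).
    exists s. split; [exact L|]. now rewrite (Hf _ z), E.
  - intros H (s & _ & E). now rewrite H in E.
Qed.

(** The answers of [join D z] in the machine's format, with [z] cut off at [m]: a computation
    depends on [z] only below [m], and for [m = 0] on [D] alone. *)
Definition fin (D : real) (m : nat) (z : real) (q : nat) : nat :=
  if Nat.even q then S (Nat.b2n (D (Nat.div2 q)))
  else if Nat.div2 q <? m then S (Nat.b2n (z (Nat.div2 q))) else 0.

(** The program tried at [n] has index [p1 n], so program [e] is diagonalised against at [pair e h]
    for every history [h]. *)
Definition diag_run (D : real) (m n : nat) (z : real) : nat :=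
  run (fin D 0 z) m (ev (p1 n) (consn n 0) 0).

Definition agrees (D : real) (m : nat) (z : real) : bool :=
  bex (fun n => halted (diag_run D m n z) && (output (diag_run D m n z) =? Nat.b2n (z n))) m.

Definition halts (D : real) (e m : nat) (z : real) : bool :=
  halted (run (fin D m z) m (ev e (consn e 0) 0)).

(* A history is a list of pairs [pair c x]. The entry [pair c x] in front of the history
   [t] requires [z (pair e t) = x] and, if [c = S i], that the [i]-th program diverges
   at [i] with oracle [join D z]; [violates] refutes this at stage [m]. *)
Definition violates (D : real) (e c t m : nat) (z : real) : bool :=
  ((0 <? p1 c) && halts D (pred (p1 c)) m z) ||
  ((pair e t <? m) && negb (Nat.b2n (z (pair e t)) =? p2 c)).

Definition suffix (h i : nat) : nat := nat_rect (fun _ => nat) h (fun _ w => tln w) i.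

Definition refuted (D : real) (e h m : nat) (z : real) : bool :=
  agrees D m z ||
  bex (fun i => negb (suffix h i =? 0) &&
         violates D e (hdn (suffix h i)) (tln (suffix h i)) m z) h.

(** Collecting the refutations of all stages below [m] makes the predicate monotone in [m], as
    compactness requires. *)
Definition killed (D : real) (e h m : nat) (z : real) : bool :=
  bex (fun i => refuted D e h i z) m.

Definition empty_by (D : real) (e h m : nat) : bool := ball m (killed D e h m).

Definition forced (D : real) (e h m n i : nat) : bool :=
  (n <? m) && ball m (fun z => killed D e h m z || (Nat.b2n (z n) =? i)).

(** * Primitive recursiveness of the stage predicates *)

Lemma rex_bex k N f :
  rex k N -> rex (S (S k)) (fun D a => Nat.b2n (f D (nth 0 a 0) (tl (tl a)))) ->
  rex k (fun D a => Nat.b2n (bex (fun y => f D y a) (N D a))).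
Proof.
  intros HN Hf.
  by_ext (fun D a => nat_rect (fun _ => nat) 0
    (fun y w => if 0 <? w then 1 else Nat.b2n (f D y a)) (N D a)).
  induction (N D a) as [|n IH]; cbn [nat_rect bex]; [reflexivity|].
  rewrite IH. fold (bex (fun y => f D y a) n). now destruct (bex _ n).
Qed.
Hint Resolve rex_bex : rx.

Lemma rex_testbit k E1 E2 : rex k E1 -> rex k E2 ->
  rex k (fun D a => Nat.b2n (Nat.testbit (E1 D a) (E2 D a))).
Proof.
  apply (rex_app2 (fun _ x y => Nat.b2n (Nat.testbit x y))).
  by_ext (fun (_ : real) a => Nat.b2n (Nat.odd
    (nat_rect (fun _ => nat) (nth 0 a 0) (fun _ w => Nat.div2 w) (nth 1 a 0)))).
  f_equal. generalize (nth 0 a 0). induction (nth 1 a 0) as [|n IH]; intros x; [reflexivity|].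
  cbn [Nat.testbit]. rewrite <- IH. f_equal.
  clear IH. induction n as [|n IH]; [reflexivity|]. cbn [nat_rect] in *. now rewrite IH.
Qed.
Hint Resolve rex_testbit : rx.

Lemma rex_pow2 k E : rex k E -> rex k (fun D a => 2 ^ E D a).
Proof.
  apply (rex_app1 (fun _ => Nat.pow 2)).
  by_ext (fun (_ : real) a => nat_rect (fun _ => nat) 1 (fun _ w => w + w) (nth 0 a 0)).
  induction (nth 0 a 0) as [|n IH]; cbn [nat_rect Nat.pow]; lia.
Qed.
Hint Resolve rex_pow2 : rx.

(** A finite string enters as the binary digits of a number, because functionals take numbers as
    arguments besides their oracle. *)
Lemma rex_fin k E1 E2 E3 : rex k E1 -> rex k E2 -> rex k E3 ->
  rex k (fun D a => fin D (E1 D a) (Nat.testbit (E2 D a)) (E3 D a)).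
Proof.
  apply (rex_app3 (fun D x y z => fin D x (Nat.testbit y) z)). unfold fin. rx.
Qed.
Hint Resolve rex_fin : rx.

Lemma rex_step_frame k E1 E2 E3 E4 : rex k E1 -> rex k E2 -> rex k E3 -> rex k E4 ->
  rex k (fun D a => step_frame (E1 D a) (E2 D a) (E3 D a) (E4 D a)).
Proof.
  apply (rex_app4 (fun _ => step_frame)). unfold step_frame, evs, ret, ev, state. rx.
Qed.

Lemma rex_step_ev k E1 E2 E3 E4 : rex k E1 -> rex k E2 -> rex k E3 -> rex k E4 ->
  rex k (fun D a => step_ev (E1 D a) (E2 D a) (E3 D a) (E4 D a)).
Proof.
  apply (rex_app4 (fun _ => step_ev)). unfold step_ev, nthn, evs, ret, ev, state. rx.
Qed.
Hint Resolve rex_step_frame rex_step_ev : rx.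

Lemma rex_run k E1 E2 E3 E4 : rex k E1 -> rex k E2 -> rex k E3 -> rex k E4 ->
  rex k (fun D a => run (fin D (E1 D a) (Nat.testbit (E2 D a))) (E3 D a) (E4 D a)).
Proof.
  apply (rex_app4 (fun D x y => run (fin D x (Nat.testbit y)))).
  unfold run, step, step_ret, step_evs, ret, ev, state. rx.
Qed.
Hint Resolve rex_run : rx.

Lemma rex_halts k E1 E2 E3 : rex k E1 -> rex k E2 -> rex k E3 ->
  rex k (fun D a => Nat.b2n (halts D (E1 D a) (E2 D a) (Nat.testbit (E3 D a)))).
Proof.
  apply (rex_app3 (fun D x y z => Nat.b2n (halts D x y (Nat.testbit z)))).
  unfold halts, halted, ev, state. rx.
Qed.

Lemma rex_agrees k E1 E2 : rex k E1 -> rex k E2 ->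
  rex k (fun D a => Nat.b2n (agrees D (E1 D a) (Nat.testbit (E2 D a)))).
Proof.
  apply (rex_app2 (fun D x y => Nat.b2n (agrees D x (Nat.testbit y)))).
  unfold agrees, diag_run, halted, output, ev, state. rx.
Qed.
Hint Resolve rex_halts rex_agrees : rx.

Lemma rex_violates k E1 E2 E3 E4 E5 :
  rex k E1 -> rex k E2 -> rex k E3 -> rex k E4 -> rex k E5 ->
  rex k (fun D a => Nat.b2n (violates D (E1 D a) (E2 D a) (E3 D a) (E4 D a)
                                (Nat.testbit (E5 D a)))).
Proof.
  apply (rex_app5 (fun D x y z u v => Nat.b2n (violates D x y z u (Nat.testbit v)))).
  unfold violates. rx.
Qed.
Hint Resolve rex_violates : rx.

Lemma rex_killed k E1 E2 E3 E4 : rex k E1 -> rex k E2 -> rex k E3 -> rex k E4 ->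
  rex k (fun D a => Nat.b2n (killed D (E1 D a) (E2 D a) (E3 D a) (Nat.testbit (E4 D a)))).
Proof.
  apply (rex_app4 (fun D x y z u => Nat.b2n (killed D x y z (Nat.testbit u)))).
  unfold killed, refuted, suffix. rx.
Qed.
Hint Resolve rex_killed : rx.

Lemma rex_empty_by k E1 E2 E3 : rex k E1 -> rex k E2 -> rex k E3 ->
  rex k (fun D a => Nat.b2n (empty_by D (E1 D a) (E2 D a) (E3 D a))).
Proof.
  apply (rex_app3 (fun D x y z => Nat.b2n (empty_by D x y z))).
  unfold empty_by, ball. rx.
Qed.

Lemma rex_forced k E1 E2 E3 E4 E5 :
  rex k E1 -> rex k E2 -> rex k E3 -> rex k E4 -> rex k E5 ->
  rex k (fun D a => Nat.b2n (forced D (E1 D a) (E2 D a) (E3 D a) (E4 D a) (E5 D a))).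
Proof.
  apply (rex_app5 (fun D x y z u v => Nat.b2n (forced D x y z u v))).
  unfold forced, ball. rx.
Qed.
Hint Resolve rex_empty_by rex_forced : rx.

(** * Finite use, compactness and halting *)

Lemma fin_ext D m z z' q :
  (forall i, i < m -> z i = z' i) -> fin D m z q = fin D m z' q.
Proof.
  intros H. unfold fin. destruct (Nat.even q); [reflexivity|].
  destruct (Nat.ltb_spec (Nat.div2 q) m); [now rewrite H | reflexivity].
Qed.

Lemma run_ext o o' n s : (forall q, o q = o' q) -> run o n s = run o' n s.
Proof. intros H. destruct (run_use o' n s) as [u Hu]. now apply Hu. Qed.

Lemma refuted_ext D e h m z z' :
  (forall i, i < m -> z i = z' i) -> refuted D e h m z = refuted D e h m z'.
Proof.
  intros H. unfold refuted, agrees, violates, halts, diag_run. f_equal.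
  - apply bex_ext. intros n Hn. rewrite H by assumption.
    rewrite (run_ext (fin D 0 z) (fin D 0 z')); [reflexivity|].
    intros q. apply fin_ext. lia.
  - apply bex_ext. intros i _. f_equal. f_equal.
    + f_equal. f_equal. apply run_ext. intros q. now apply fin_ext.
    + destruct (Nat.ltb_spec (pair e (tln (suffix h i))) m); [now rewrite H | reflexivity].
Qed.

Lemma killed_ext D e h m z z' :
  (forall i, i < m -> z i = z' i) -> killed D e h m z = killed D e h m z'.
Proof.
  intros H. apply bex_ext. intros n Hn. apply refuted_ext. intros. apply H. lia.
Qed.

Lemma killed_spec D e h m z :
  killed D e h m z = true <-> exists i, i < m /\ refuted D e h i z = true.
Proof. apply bex_spec. Qed.

Lemma killed_le D e h m m' z :
  m <= m' -> killed D e h m z = true -> killed D e h m' z = true.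
Proof.
  rewrite !killed_spec. intros L (i & Li & H). exists i. split; [lia | exact H].
Qed.

Lemma empty_by_spec D e h m :
  empty_by D e h m = true <-> forall z, killed D e h m z = true.
Proof. apply ball_spec. apply killed_ext. Qed.

Lemma forced_spec D e h m n i :
  forced D e h m n i = true <->
  n < m /\ forall z, killed D e h m z = true \/ Nat.b2n (z n) = i.
Proof.
  unfold forced. rewrite andb_true_iff, Nat.ltb_lt. split.
  - intros [L H]. split; [exact L|]. intros z.
    rewrite ball_spec in H.
    + specialize (H z). now rewrite orb_true_iff, Nat.eqb_eq in H.
    + intros z1 z2 Hz. rewrite (killed_ext _ _ _ _ _ z2), Hz by assumption. reflexivity.
  - intros [L H]. split; [exact L|]. apply ball_spec.
    + intros z1 z2 Hz. rewrite (killed_ext _ _ _ _ _ z2), Hz by assumption. reflexivity.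
    + intros z. rewrite orb_true_iff, Nat.eqb_eq. apply H.
Qed.

Definition in_class (D : real) (e h : nat) (z : real) : Prop :=
  forall m, refuted D e h m z = false.

Lemma in_class_killed D e h z :
  in_class D e h z <-> forall m, killed D e h m z = false.
Proof.
  split; intros H m.
  - apply not_true_iff_false. rewrite killed_spec. intros (i & _ & E). now rewrite H in E.
  - apply not_true_iff_false. intros E.
    specialize (H (S m)). apply not_true_iff_false in H. apply H.
    apply killed_spec. exists m. split; [lia | exact E].
Qed.

Lemma suffix_cons c h i : suffix (consn c h) (S i) = suffix h i.
Proof.
  unfold suffix. induction i as [|i IH]; [apply tln_cons|].
  cbn [nat_rect] in *. now rewrite IH.
Qed.

(** Taking tails lowers the code, so a history [h] has at most [h] nonempty suffixes and the bound
    [h] in [refuted] covers all of them. *)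
Lemma suffix_lt h i : suffix h i <> 0 -> i < h.
Proof.
  assert (H : suffix h i <= h - i).
  { induction i as [|i IH]; cbn; [lia|]. fold (suffix h i).
    destruct (suffix h i) as [|k] eqn:E.
    - unfold tln. cbn. rewrite p2_0. lia.
    - unfold tln. cbn [pred]. pose proof (p_le k). lia. }
  lia.
Qed.

Lemma refuted_spec D e h m z :
  refuted D e h m z = true <->
  agrees D m z = true \/ exists i, suffix h i <> 0 /\
    violates D e (hdn (suffix h i)) (tln (suffix h i)) m z = true.
Proof.
  unfold refuted. rewrite orb_true_iff, bex_spec. apply or_iff_compat_l. split.
  - intros (i & _ & H). apply andb_prop in H as [H1 H2].
    exists i. split; [|exact H2]. now apply negb_true_iff, Nat.eqb_neq in H1.
  - intros (i & H1 & H2). exists i. split; [now apply suffix_lt|].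
    rewrite H2, (proj2 (Nat.eqb_neq _ _) H1). reflexivity.
Qed.

Lemma refuted_nil D e m z : refuted D e 0 m z = agrees D m z.
Proof. unfold refuted. cbn. apply orb_false_r. Qed.

Lemma refuted_cons D e c h m z :
  refuted D e (consn c h) m z = refuted D e h m z || violates D e c h m z.
Proof.
  apply eq_true_iff_eq. rewrite orb_true_iff, !refuted_spec. split.
  - intros [H|([|i] & H1 & H2)]; [auto| |].
    + right. cbn [suffix nat_rect] in H2. now rewrite hdn_cons, tln_cons in H2.
    + rewrite suffix_cons in *. left. right. eauto.
  - intros [[H|(i & H1 & H2)]|H]; [auto| |].
    + right. exists (S i). rewrite suffix_cons. auto.
    + right. exists 0. cbn [suffix nat_rect]. now rewrite hdn_cons, tln_cons.
Qed.

(** König's lemma on the binary tree. If no stage works for all reals, bits are chosen one at a time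
    so that each [K m] is still escaped by some real with the chosen beginning; the limit then
    escapes every [K m]. *)
Lemma compactness (K : nat -> real -> Prop) :
  (forall m z z', (forall i, i < m -> z i = z' i) -> K m z -> K m z') ->
  (forall m m' z, m <= m' -> K m z -> K m' z) ->
  (forall z, exists m, K m z) -> exists m, forall z, K m z.
Proof.
  intros Hext Hle Hall. apply NNPP. intros Hno.
  set (good := fun n (z : real) => forall m, exists z',
    (forall i, i < n -> z' i = z i) /\ ~ K m z').
  set (upd := fun (z : real) n b i => if i =? n then b else z i).
  assert (Hgood : forall n z, good n z -> good (S n) (upd z n true) \/ good (S n) (upd z n false)).
  { intros n z G. apply NNPP. intros N. apply not_or_and in N as [N1 N2].
    apply not_all_ex_not in N1 as [m1 N1]. apply not_all_ex_not in N2 as [m2 N2].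
    (* If neither bit is good, every real with the given beginning satisfies [K m1] or [K m2], hence
       [K (m1 + m2)], against [G]. *)
    destruct (G (m1 + m2)) as (z' & Hz & HK).
    destruct (z' n) eqn:E; [apply N1 | apply N2]; exists z'; split;
      try (intros HK'; apply HK; revert HK'; apply Hle; lia);
      intros i Li; unfold upd; destruct (Nat.eqb_spec i n) as [->|]; auto; apply Hz; lia. }
  set (next := fun n z => if excluded_middle_informative (good (S n) (upd z n true))
                          then upd z n true else upd z n false).
  set (zs := nat_rect (fun _ => real) (fun _ => false) next).
  assert (Hzs : forall n, good n (zs n)).
  { induction n as [|n IH].
    - intros m. apply not_ex_all_not with (n := m) in Hno.
      apply not_all_ex_not in Hno as [z Hz]. exists z. split; [lia | exact Hz].
    - change (zs (S n)) with (next n (zs n)). unfold next.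
      destruct (excluded_middle_informative _) as [G|G]; [exact G|].
      now destruct (Hgood n (zs n) IH). }
  assert (Hstable : forall n i, i < n -> zs n i = zs (S i) i).
  { induction n as [|n IH]; intros i L; [lia|].
    destruct (Nat.eq_dec i n) as [->|]; [reflexivity|].
    rewrite <- (IH i) by lia. change (zs (S n)) with (next n (zs n)). unfold next.
    destruct (excluded_middle_informative _); unfold upd;
      now rewrite (proj2 (Nat.eqb_neq i n)) by assumption. }
  (* The limit real: bit [i] is settled from [zs (S i)] on. *)
  destruct (Hall (fun i => zs (S i) i)) as [m Hm].
  destruct (Hzs m m) as (z' & Hz & HK). apply HK.
  revert Hm. apply Hext. intros i Li.
  rewrite Hz by assumption. symmetry. now apply Hstable.
Qed.

Lemma empty_compact D e h :
  (forall z, ~ in_class D e h z) -> exists m, empty_by D e h m = true.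
Proof.
  intros H. destruct (compactness (fun m z => killed D e h m z = true)) as [m Hm].
  - intros m z z' E. now rewrite (killed_ext _ _ _ _ _ _ E).
  - intros m m' z L. now apply killed_le.
  - intros z. apply NNPP. intros N. apply (H z). apply in_class_killed. intros m.
    apply not_true_iff_false. intros E. eauto.
  - exists m. now apply empty_by_spec.
Qed.

Definition fin_oracle (D : real) (m : nat) (z : real) : oracle := fun q =>
  if Nat.even q then Some (D (Nat.div2 q))
  else if Nat.div2 q <? m then Some (z (Nat.div2 q)) else None.

Lemma fin_answers D m z q : answers (fin_oracle D m z) q = fin D m z q.
Proof.
  unfold answers, fin_oracle, fin. destruct (Nat.even q); [reflexivity|].
  now destruct (Nat.div2 q <? m).
Qed.

Lemma converges_join_halts A Z e :
  converges (decode e) (real_oracle (join A Z)) e <-> exists m, halts A e m Z = true.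
Proof.
  split.
  - intros [v E]. destruct (reaches_eval _ _ _ _ E e 0 eq_refl) as [n En].
    destruct (run_use (answers (real_oracle (join A Z))) n (ev e (enc [e]) 0)) as [u Hu].
    (* The stage has to allow [n] steps as well as all queries below [u]. *)
    exists (n + u). unfold halts. change (consn e 0) with (enc [e]).
    assert (Er : run (fin A (n + u) Z) n (ev e (enc [e]) 0) = ret v 0).
    { rewrite Hu; [exact En|]. intros q Lq.
      unfold fin, answers, real_oracle, join. destruct (Nat.even q); [reflexivity|].
      pose proof (Nat.div2_decr q q ltac:(lia)).
      now rewrite (proj2 (Nat.ltb_lt (Nat.div2 q) (n + u))) by lia. }
    apply (halted_run_le _ n); [lia|]. rewrite Er. apply halted_ret.
  - intros [m H]. unfold halts in H. change (consn e 0) with (enc [e]) in H.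
    rewrite <- (run_ext _ _ m _ (fin_answers A m Z)) in H.
    apply eval_of_halted in H as (v & m' & _ & E & _).
    exists v. revert E. apply eval_mono. unfold fin_oracle, real_oracle, join.
    intros q b. destruct (Nat.even q); [auto|].
    destruct (Nat.div2 q <? m); [auto | discriminate].
Qed.

(** Queries the even half of a join, so that a program for oracle [A] runs over [join A z] without
    consulting [z]. *)
Definition even_query : prog := Comp Orc [Comp add_prog [Proj 0; Proj 0]].

Lemma diag_run_eval A Q e n v :
  decode e = subst_orc even_query Q -> p1 n = e -> eval (real_oracle A) Q [n] v ->
  exists m0, forall m z, m0 <= m ->
    halted (diag_run A m n z) = true /\ output (diag_run A m n z) = v.
Proof.
  intros De Hn E.
  assert (E' : eval (fin_oracle A 0 A) (decode e) [n] v).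
  { rewrite De. revert E. apply eval_subst_orc. intros i b [= <-].
    eapply eval_comp1.
    - eapply eval_comp2; [apply e_proj | apply e_proj | apply eval_add_prog].
    - apply (e_orc _ [i + i] (A i)). unfold fin_oracle. cbn [hd nth].
      replace (i + i) with (2 * i) by lia. now rewrite Nat.even_even, Nat.div2_double. }
  destruct (reaches_eval _ _ _ _ E' e 0 eq_refl) as [m0 Em].
  exists m0. intros m z L. unfold diag_run. rewrite Hn.
  assert (Er : run (fin A 0 z) m0 (ev e (consn n 0) 0) = ret v 0).
  { rewrite <- Em. apply run_ext. intros q. rewrite fin_answers. apply fin_ext. lia. }
  destruct (halted_run_le (fin A 0 z) m0 m (ev e (consn n 0) 0) L) as [H1 H2].
  - rewrite Er. apply halted_ret.
  - rewrite H2, Er, output_ret. auto.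
Qed.

(** * Indices *)

Lemma rex_program k F : rex k F ->
  exists p, forall D a, length a = k -> eval (real_oracle D) p a (F D a).
Proof.
  intros (p & q & b & Hq & Hm & Hp). exists p. intros D a L. now apply Hp.
Qed.

Lemma eval_mu_least O p a f :
  (forall m, eval O p (m :: a) (f m)) -> (exists m, f m = 0) ->
  exists m, f m = 0 /\ eval O (Mu p) a m.
Proof.
  intros Hp [m Hm]. induction m as [m IH] using lt_wf_ind.
  destruct (classic (exists y, y < m /\ f y = 0)) as [(y & L & Hy)|N].
  - exact (IH y L Hy).
  - exists m. split; [exact Hm|]. constructor; [rewrite <- Hm; apply Hp|].
    intros y L. exists (f y). split; [|apply Hp]. intros Hy. apply N. eauto.
Qed.

Lemma jump_true D e : jump D e = true <-> converges (decode e) (real_oracle D) e.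
Proof. unfold jump. now destruct (excluded_middle_informative _). Qed.

(** Turns a Sigma^0_1 question about [D] into one query to the jump, at a position that is primitive
    recursive in the parameter and the same for all [D]. *)
Lemma sigma1_index F : rex 2 F ->
  exists c, forall D n, jump D (smn c n) = true <-> exists m, F D [m; n] = 0.
Proof.
  intros [p Hp]%rex_program. destruct (decode_surj (Mu p)) as [c Hc].
  exists c. intros D n. rewrite jump_true, converges_smn, Hc. split.
  - intros [v E]. exists v. inversion E as [| | | | | | |? ? ? E0 _]; subst.
    eapply eval_functional; [now apply Hp | exact E0].
  - intros H. destruct (eval_mu_least (real_oracle D) p [n] (fun m => F D [m; n])) as (m & _ & E);
      eauto.
Qed.

Lemma rex_smn k E1 E2 : rex k E1 -> rex k E2 ->
  rex k (fun D a => smn (E1 D a) (E2 D a)).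
Proof. apply (rex_app2 (fun _ => smn)). unfold smn, const_code. rx. Qed.
Hint Resolve rex_smn : rx.

Lemma tt_le_jump Y : tt_le Y (jump Y).
Proof.
  (* The tested condition ignores the search variable: the search stops at once or never. *)
  destruct (sigma1_index (fun D a => Nat.b2n (negb (D (nth 1 a 0))))) as [c Hc]; [rx|].
  apply (tt_le_rex _ _ (fun D a => Nat.b2n (D (smn c (nth 0 a 0))))); [rx|].
  intros n. f_equal. cbn [nth]. apply eq_true_iff_eq. rewrite Hc. cbn [nth].
  split; [intros [_ H]; now destruct (Y n) | intros ->; now exists 0].
Qed.

(* On input [pair e h] the program reads off its own index [e], so it can look for a
   bit forced by the class of [h] at the very position [pair e h] where the class
   demands a value different from the output. *)
Definition diagonal_code (e : nat) : Prop := forall A h,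
  (exists m i, i <= 1 /\ forced A e h m (pair e h) i = true) ->
  exists m i m0, forced A e h m (pair e h) i = true /\
    forall m' z, m0 <= m' ->
      halted (diag_run A m' (pair e h) z) = true /\ output (diag_run A m' (pair e h) z) = i.

Lemma diagonal_code_exists : exists e, diagonal_code e.
Proof.
  set (F := fun D n m i => forced D (p1 n) (p2 n) m n i).
  destruct (rex_program 2 (fun D a =>
    Nat.b2n (negb (F D (nth 1 a 0) (nth 0 a 0) 0 || F D (nth 1 a 0) (nth 0 a 0) 1))))
    as [pT HT]; [unfold F; rx|].
  destruct (rex_program 2 (fun D a => Nat.b2n (negb (F D (nth 1 a 0) (nth 0 a 0) 0))))
    as [pV HV]; [unfold F; rx|].
  (* [Mu pT] finds the first stage at which a bit is forced; [pV] then outputs 0 if 0 is forced at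
     that stage, and 1 otherwise. *)
  set (Q := Comp pV [Mu pT; Proj 0]).
  destruct (decode_surj (subst_orc even_query Q)) as [e He].
  exists e. intros A h (m & i & Li & H). set (n := pair e h) in *.
  assert (EF : forall m i, F A n m i = forced A e h m n i).
  { intros. unfold F, n. now rewrite p1_pair, p2_pair. }
  destruct (eval_mu_least (real_oracle A) pT [n]
    (fun m => Nat.b2n (negb (F A n m 0 || F A n m 1)))) as (m1 & H1 & Em).
  { intros m1. exact (HT A [m1; n] eq_refl). }
  { exists m. rewrite !EF. destruct i as [|[|i]]; [| |lia]; rewrite H; [reflexivity|].
    now rewrite orb_true_r. }
  exists m1, (Nat.b2n (negb (F A n m1 0))).
  destruct (diag_run_eval A Q e n (Nat.b2n (negb (F A n m1 0))) He) as [m0 Hm0].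
  { apply p1_pair. }
  { eapply eval_comp2; [exact Em | apply e_proj | exact (HV A [m1; n] eq_refl)]. }
  exists m0. split; [|exact Hm0].
  (* If 0 is not forced at stage [m1], then 1 is, by the choice of [m1]. *)
  rewrite !EF in *. destruct (forced A e h m1 n 0) eqn:E0; [exact E0|].
  cbn in H1 |- *. now destruct (forced A e h m1 n 1).
Qed.

(** * Members of the classes *)

Lemma in_class_cons D e c h z :
  in_class D e (consn c h) z <->
  in_class D e h z /\ forall m, violates D e c h m z = false.
Proof.
  unfold in_class. split.
  - intros H. split; intros m; specialize (H m);
      rewrite refuted_cons, orb_false_iff in H; apply H.
  - intros [H1 H2] m. now rewrite refuted_cons, H1, H2.
Qed.

Lemma in_class_coded D e c x h z :
  in_class D e (consn (pair c x) h) z -> Nat.b2n (z (pair e h)) = x.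
Proof.
  (* The first stage that inspects the position [pair e h]. *)
  intros [_ H]%in_class_cons. specialize (H (S (pair e h))).
  unfold violates in H. apply orb_false_iff in H as [_ H].
  rewrite (proj2 (Nat.ltb_lt _ _) (Nat.lt_succ_diag_r _)), p2_pair in H.
  now apply negb_false_iff, Nat.eqb_eq in H.
Qed.

Lemma in_class_cons_0 D e x h z :
  in_class D e h z -> Nat.b2n (z (pair e h)) = x -> in_class D e (consn (pair 0 x) h) z.
Proof.
  intros H <-. apply in_class_cons. split; [exact H|]. intros m.
  unfold violates. rewrite p1_pair, p2_pair, Nat.eqb_refl. cbn. apply andb_false_r.
Qed.

Lemma in_class_cons_S D e i x h z :
  in_class D e (consn (pair (S i) x) h) z <->
  in_class D e (consn (pair 0 x) h) z /\ forall m, halts D i m z = false.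
Proof.
  split.
  - intros H. split.
    + apply in_class_cons_0; [now apply in_class_cons in H | now apply in_class_coded in H].
    + intros m. apply in_class_cons in H as [_ H]. specialize (H m).
      unfold violates in H. rewrite p1_pair in H. cbn [Nat.ltb Nat.leb pred andb] in H.
      now apply orb_false_iff in H.
  - intros [H1 H2]. apply in_class_coded in H1 as E. apply in_class_cons in H1 as [H1 _].
    apply in_class_cons. split; [exact H1|]. intros m.
    unfold violates. rewrite p1_pair, p2_pair, E, Nat.eqb_refl. cbn [pred].
    now rewrite H2, !andb_false_r.
Qed.

(** The member takes the value 1 exactly where the diagonal computation halts with output 0. *)
Lemma in_class_nil D e : exists z, in_class D e 0 z.
Proof.
  set (z0 := fun _ : nat => false).
  assert (Ez : forall m n z, diag_run D m n z = diag_run D m n z0).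
  { intros. apply run_ext. intros q. apply fin_ext. lia. }
  set (P := fun n => exists m, halted (diag_run D m n z0) = true /\
                               output (diag_run D m n z0) = 0).
  exists (fun n => if excluded_middle_informative (P n) then true else false).
  intros m. rewrite refuted_nil. apply not_true_iff_false.
  unfold agrees. rewrite bex_spec. intros (n & _ & H).
  rewrite Ez in H. apply andb_prop in H as [H1 H2]. apply Nat.eqb_eq in H2.
  destruct (excluded_middle_informative (P n)) as [(m' & H1' & H2')|N].
  - destruct (halted_run_le _ m (m + m') _ ltac:(lia) H1) as [_ E1].
    destruct (halted_run_le _ m' (m + m') _ ltac:(lia) H1') as [_ E2].
    unfold diag_run in *. cbn in H2. congruence.
  - apply N. exists m. auto.
Qed.

(** If no member of the class had bit [x] at [n], compactness would give a stage forcing the other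
    bit. The program [e] then outputs some forced bit at [n]; [z] has this bit because it is forced,
    and must differ from it by diagonal non-computability. *)
Lemma in_class_both D e h z x : diagonal_code e -> in_class D e h z ->
  exists z', in_class D e (consn (pair 0 (Nat.b2n x)) h) z'.
Proof.
  intros De Hz. apply NNPP. intros N. set (n := pair e h).
  (* The conjunct [n < m] makes the condition depend only on the bits below [m]. *)
  destruct (compactness (fun m z => n < m /\ (killed D e h m z = true \/ z n = negb x)))
    as [m Hm].
  - intros m y y' E [L H]. split; [exact L|].
    now rewrite <- (killed_ext _ _ _ _ _ _ E), <- (E n L).
  - intros m m' y L [Ln H]. split; [lia|].
    destruct H as [H|H]; [left | now right]. revert H. now apply killed_le.
  - intros y. destruct (classic (exists m, killed D e h m y = true)) as [[m Hm]|Ny].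
    + exists (m + S n). split; [lia|]. left. revert Hm. apply killed_le. lia.
    + exists (S n). split; [lia|]. right.
      apply NNPP. intros Nx. apply N. exists y. apply in_class_cons_0.
      * apply in_class_killed. intros m. apply not_true_iff_false. eauto.
      * fold n. now destruct (y n), x.
  - destruct (De D h) as (m1 & i & m0 & Hf & Hd).
    { exists m, (Nat.b2n (negb x)). split; [destruct x; cbn; lia|].
      apply forced_spec. split; [apply (Hm z)|]. intros y.
      destruct (Hm y) as [_ [H|H]]; [now left|]. right. now rewrite <- H. }
    apply forced_spec in Hf as [_ Hf]. destruct (Hf z) as [Hk|Hi].
    + apply in_class_killed with (m := m1) in Hz. congruence.
    (* Late enough for the computation to have halted and for [agrees] to inspect position [n]. *)
    + specialize (Hz (m0 + S n)). destruct (Hd (m0 + S n) z ltac:(lia)) as [H1 H2].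
      apply not_true_iff_false in Hz. apply Hz. apply refuted_spec. left.
      apply bex_spec. exists n. split; [lia|].
      fold n in H1, H2, Hi. now rewrite H1, H2, Hi, Nat.eqb_refl.
Qed.

(** * The construction *)

Definition candidate (x e h : nat) : nat := consn (pair (S e) x) h.

(* [x] is the bit coded at stage [e]; [j] tells whether the class of the candidate is empty. *)
Definition extend (x j e h : nat) : nat := consn (pair (cond j 0 (S e)) x) h.

Definition history (X : real) (J : nat -> bool) (e : nat) : nat :=
  nat_rect (fun _ => nat) 0
    (fun i h => extend (Nat.b2n (X i)) (Nat.b2n (J (candidate (Nat.b2n (X i)) i h))) i h) e.

Lemma history_S X J e :
  history X J (S e) = extend (Nat.b2n (X e))
    (Nat.b2n (J (candidate (Nat.b2n (X e)) e (history X J e)))) e (history X J e).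
Proof. reflexivity. Qed.

(** [qx i h] is the position in [D] of the bit coded at stage [i], and [qj i c] that of the decision
    on the candidate [c]. Different choices recover the same history from different oracles. *)
Definition history_from (qx qj : nat -> nat -> nat) (D : real) (e : nat) : nat :=
  nat_rect (fun _ => nat) 0
    (fun i h => extend (Nat.b2n (D (qx i h)))
                  (Nat.b2n (D (qj i (candidate (Nat.b2n (D (qx i h))) i h)))) i h) e.

Lemma history_from_eq qx qj D X J :
  (forall e, D (qx e (history X J e)) = X e) ->
  (forall e, let c := candidate (Nat.b2n (X e)) e (history X J e) in D (qj e c) = J c) ->
  forall e, history_from qx qj D e = history X J e.
Proof.
  intros HX HJ. induction e as [|e IH]; [reflexivity|].
  rewrite history_S. cbn [history_from nat_rect]. fold (history_from qx qj D e).
  now rewrite IH, HX, HJ.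
Qed.

Lemma rex_history_from qx qj :
  (forall k E1 E2, rex k E1 -> rex k E2 -> rex k (fun D a => qx (E1 D a) (E2 D a))) ->
  (forall k E1 E2, rex k E1 -> rex k E2 -> rex k (fun D a => qj (E1 D a) (E2 D a))) ->
  forall k E, rex k E -> rex k (fun D a => history_from qx qj D (E D a)).
Proof.
  intros Hx Hj. apply (rex_app1 (history_from qx qj)).
  unfold history_from, extend, candidate. rx.
Qed.

Lemma tt_le_bit qx qj D X J :
  (forall k E1 E2, rex k E1 -> rex k E2 -> rex k (fun D a => qx (E1 D a) (E2 D a))) ->
  (forall k E1 E2, rex k E1 -> rex k E2 -> rex k (fun D a => qj (E1 D a) (E2 D a))) ->
  (forall e, D (qx e (history X J e)) = X e) ->
  (forall e, let c := candidate (Nat.b2n (X e)) e (history X J e) in D (qj e c) = J c) ->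
  tt_le X D.
Proof.
  intros Rx Rj HX HJ. pose proof (rex_history_from qx qj Rx Rj) as Rh.
  apply (tt_le_rex _ _ (fun D a =>
    Nat.b2n (D (qx (nth 0 a 0) (history_from qx qj D (nth 0 a 0)))))); [rx|].
  intros e. cbn [nth]. now rewrite (history_from_eq qx qj D X J HX HJ), HX.
Qed.

Lemma tt_le_answer qx qj D X J C :
  (forall k E1 E2, rex k E1 -> rex k E2 -> rex k (fun D a => qx (E1 D a) (E2 D a))) ->
  (forall k E1 E2, rex k E1 -> rex k E2 -> rex k (fun D a => qj (E1 D a) (E2 D a))) ->
  (forall e, D (qx e (history X J e)) = X e) ->
  (forall e, let c := candidate (Nat.b2n (X e)) e (history X J e) in D (qj e c) = J c) ->
  (forall e, C e = J (candidate (Nat.b2n (X e)) e (history X J e))) ->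
  tt_le C D.
Proof.
  intros Rx Rj HX HJ HC. pose proof (rex_history_from qx qj Rx Rj) as Rh.
  apply (tt_le_rex _ _ (fun D a => let h := history_from qx qj D (nth 0 a 0) in
    Nat.b2n (D (qj (nth 0 a 0) (candidate (Nat.b2n (D (qx (nth 0 a 0) h))) (nth 0 a 0) h)))));
    [unfold candidate; cbv zeta; rx|].
  intros e. cbn [nth]. cbv zeta.
  now rewrite (history_from_eq qx qj D X J HX HJ), HX, HJ, HC.
Qed.

Definition emptiness (D : real) (e : nat) (J : nat -> bool) : Prop :=
  forall h, J h = true <-> forall z, ~ in_class D e h z.

Lemma emptiness_index e : exists c, forall D, emptiness D e (fun h => jump D (smn c h)).
Proof.
  destruct (sigma1_index (fun D a => Nat.b2n (negb (empty_by D e (nth 1 a 0) (nth 0 a 0)))))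
    as [c Hc]; [rx|].
  exists c. intros D h. rewrite Hc. cbn [nth]. split.
  - intros [m Hm] z Hz. destruct (empty_by D e h m) eqn:E; [|discriminate].
    apply in_class_killed with (m := m) in Hz.
    rewrite empty_by_spec in E. now rewrite E in Hz.
  - intros [m Hm]%empty_compact. exists m. now rewrite Hm.
Qed.

(** When the candidate class is empty, the divergence requirement is dropped, and [in_class_both]
    makes the coded bit alone possible. *)
Lemma history_nonempty D e X J : diagonal_code e -> emptiness D e J ->
  forall n, exists z, in_class D e (history X J n) z.
Proof.
  intros De HJ. induction n as [|n [z Hz]]; [apply in_class_nil|].
  rewrite history_S. set (h := history X J n) in *. unfold extend.
  destruct (J (candidate (Nat.b2n (X n)) n h)) eqn:E; cbn [Nat.b2n cond nat_rect].
  - now apply in_class_both with z.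
  - apply NNPP. intros N. apply not_true_iff_false in E. apply E, HJ.
    intros y Hy. eauto.
Qed.

(** The classes decrease along the histories. Compactness is applied to stage [m] of the [m]-th
    history, so an empty intersection would make one single class empty. *)
Lemma history_limit D e X J : diagonal_code e -> emptiness D e J ->
  exists z, forall n, in_class D e (history X J n) z.
Proof.
  intros De HJ. apply NNPP. intros N.
  assert (Hh : forall n n' m z, n <= n' -> killed D e (history X J n) m z = true ->
    killed D e (history X J n') m z = true).
  { intros n n' m z L H. induction L as [|n' _ IH]; [exact H|].
    apply killed_spec in IH as (i & Li & Hi). apply killed_spec. exists i. split; [exact Li|].
    rewrite history_S. unfold extend. now rewrite refuted_cons, Hi. }
  destruct (compactness (fun m z => killed D e (history X J m) m z = true)) as [m Hm].
  - intros m z z' E. now rewrite (killed_ext _ _ _ _ _ _ E).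
  - intros m m' z L H. apply (Hh m); [exact L|]. revert H. now apply killed_le.
  - intros z. apply not_ex_all_not with (n := z) in N.
    apply not_all_ex_not in N as [n Hn].
    apply NNPP. intros Nm. apply Hn, in_class_killed. intros m.
    (* A refutation of history [n] by stage [m] persists for history [n + m] at stage [n + m]. *)
    apply not_true_iff_false. intros H. apply Nm. exists (n + m).
    apply (Hh n); [lia|]. revert H. apply killed_le. lia.
  - destruct (history_nonempty D e X J De HJ m) as [z Hz].
    apply in_class_killed with (m := m) in Hz. now rewrite Hm in Hz.
Qed.

Lemma history_coded D e X J z : (forall n, in_class D e (history X J n) z) ->
  forall n, z (pair e (history X J n)) = X n.
Proof.
  intros H n. specialize (H (S n)). rewrite history_S in H.
  apply in_class_coded in H. now apply Nat.b2n_inj.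
Qed.

(** If the candidate class is empty, then [z], which meets its other requirements, must fail the
    divergence requirement. Otherwise that requirement was added, and [z] satisfies it. *)
Lemma history_jump D e X J z : emptiness D e J ->
  (forall n, in_class D e (history X J n) z) ->
  forall n, jump (join D z) n = J (candidate (Nat.b2n (X n)) n (history X J n)).
Proof.
  intros HJ H n. specialize (H (S n)). rewrite history_S in H.
  set (h := history X J n) in *. unfold extend in H.
  apply eq_true_iff_eq. rewrite jump_true, converges_join_halts.
  destruct (J (candidate (Nat.b2n (X n)) n h)) eqn:E; cbn [Nat.b2n cond nat_rect] in H.
  - split; [reflexivity|]. intros _. apply NNPP. intros N.
    rewrite (HJ (candidate _ _ _)) in E. apply (E z). apply in_class_cons_S.
    split; [exact H|]. intros m. apply not_true_iff_false. eauto.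
  - apply in_class_cons_S in H as [_ H]. split; [|discriminate].
    intros [m Hm]. now rewrite H in Hm.
Qed.

Theorem mainTheorem3 (A X : real) :
  tt_le (jump A) X ->
  exists Y : real,
    tt_le A Y /\ tt_equiv X (jump Y) /\ tt_equiv (jump Y) (join Y (jump A)).
Proof.
  intros HAX.
  destruct diagonal_code_exists as [e De].
  destruct (emptiness_index e) as [c Hc]. specialize (Hc A).
  set (J := fun h => jump A (smn c h)) in *.
  destruct (history_limit A e X J De Hc) as [Z HZ].
  pose proof (history_coded A e X J Z HZ) as HX.
  pose proof (history_jump A e X J Z Hc HZ) as HY.
  set (Y := join A Z) in *. exists Y.
  (* [Z] is the odd half of [Y], and [Y] the even half of [join Y B]; hence an odd position,
     doubled. *)
  set (pos := fun (_ h : nat) => S (pair e h + pair e h) + S (pair e h + pair e h)).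
  set (ask := fun (_ h : nat) => S (smn c h + smn c h)).
  assert (Rpos : forall k E1 E2, rex k E1 -> rex k E2 ->
    rex k (fun D a => pos (E1 D a) (E2 D a))) by (intros; unfold pos; rx).
  assert (Rask : forall k E1 E2, rex k E1 -> rex k E2 ->
    rex k (fun D a => ask (E1 D a) (E2 D a))) by (intros; unfold ask; rx).
  assert (Hpos : forall B n, join Y B (pos n (history X J n)) = X n).
  { intros B n. unfold pos. rewrite join_double. unfold Y. now rewrite join_double_S. }
  assert (Hask : forall B n h, join B (jump A) (ask n h) = J h).
  { intros B n h. exact (join_double_S B (jump A) (smn c h)). }
  assert (T1 : tt_le (jump Y) (join X (jump A))).
  (* [X] supplies the bits and [jump A] the decisions, which by [HY] are the values of [jump Y]. *)
  { apply (tt_le_answer (fun i _ => i + i) ask _ X J); auto.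
    - intros; rx.
    - intros n. apply join_double. }
  assert (T2 : tt_le X (join Y (jump Y))).
  (* Here the decision of stage [i] is read off as [jump Y i], whatever the candidate. *)
  { apply (tt_le_bit pos (fun i _ => S (i + i)) _ X J); auto.
    - intros; rx.
    - intros n. cbv zeta. rewrite join_double_S. apply HY. }
  assert (T3 : tt_le X (join Y (jump A))) by (apply (tt_le_bit pos ask _ X J); auto).
  assert (T4 : tt_le X (jump Y)).
  { apply (tt_le_trans _ _ _ T2), tt_le_join; [apply tt_le_jump | apply tt_le_refl]. }
  split; [apply tt_le_join_l|]. repeat split.
  - exact T4.
  - apply (tt_le_trans _ _ _ T1), tt_le_join; [apply tt_le_refl | exact HAX].
  - apply (tt_le_trans _ _ _ T1), tt_le_join; [exact T3 | apply tt_le_join_r].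
  (* [jump A] reduces to [X] by hypothesis, and [X] to [jump Y] by [T4]. *)
  - apply tt_le_join; [apply tt_le_jump | exact (tt_le_trans _ _ _ HAX T4)].
Qed.
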